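(* Let $k\ge0$, $d\ge3$ and $N\ge k+3$ be integers. The variety $Dual_{k,d,N}\subset\mathbb P(S^d(\mathbb C^N)^* )$ has equations given by a copy of the irreducible $SL_N$-module with highest weight $$\Omega(k,d)=(d-1)(d-2)(k+2)\,\omega_1+\big(d(k+2)-2k-5\big)\,\omega_2+2\,\omega_{k+3},$$ and these equations have degree $(k+2)(d-1)$. That is: the polynomials $E_{f,u,v}$ on $S^d(\mathbb C^N)^*$ defined in the context, taken over all $f,u,v$ such that $u,v\in F=\langle f_1,\dots,f_{k+3}\rangle$, are homogeneous of degree $(k+2)(d-1)$, vanish on $Dual_{k,d,N}$, and span an $SL_N$-module isomorphic to the irreducible module of highest weight $\Omega(k,d)$.
   Context: Let $W=\mathbb C^N$ and let $S^dW^*$ be the space of homogeneous polynomials of degree $d$ on $W$. For irreducible $P\in S^dW^*$, $Z(P)\subset\mathbb PW$ is the hypersurface defined by $P$ and its dual variety $Z(P)^*$ is the Zariski closure of the set of tangent hyperplanes to $Z(P)$. $Dual_{k,d,N}\subset\mathbb P(S^dW^* )$ is the Zariski closure of the set of irreducible hypersurfaces of degree $d$ in $\mathbb PW\simeq\mathbb P^{N-1}$ whose dual variety has dimension at most $k$. $\omega_i$ is the $i$-th fundamental weight, the highest weight of $\Lambda^iW$; polynomials on $S^dW^*$ are elements of $\mathrm{Sym}(S^dW)$. Put $e=(k+3)(d-2)$. For a basis $f=(f_1,\dots,f_{k+3})$ of a $(k+3)$-dimensional subspace $F\subset W$ and $P\in S^dW^*$, let $Q_f=\det\big(\partial_{f_i}\partial_{f_j}P\big)_{1\le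 i,j\le k+3}$, the determinant of the Hessian of $P$ restricted to $F$; it is a form of degree $e$ on $W$. For linearly independent $u,v\in W$ write $$P(xu+yv)=\sum_{j=0}^d p_jx^jy^{d-j},\qquad Q_f(xu+yv)=\sum_{i=0}^e q_ix^iy^{e-i},$$ and set $$E_{f,u,v}(P)=\sum_{i=d-1}^{e}\ \sum_{r\ge 0}\ \sum_{\substack{j_1+\cdots+j_r=i-d+1\\ 1\le j_s\le d}}(-1)^r\,q_i\,p_{d-j_1}\cdots p_{d-j_r}\,p_d^{\,e-d+1-r}.$$ (For $p_d\ne0$, its vanishing means that the coefficient of $x^{d-1}$ in the remainder of the Euclidean division of $Q_f(xu+v)$ by $P(xu+v)$ is zero. Up to scale, when $u,v\in F$, it depends only on the flag $\langle u\rangle\subset\langle u,v\rangle\subset F$.) *)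

(* Defs.v *)
From HB Require Import structures.
From mathcomp Require Import all_boot all_order all_algebra.
From mathcomp Require Import boolp classical_sets reals complex mpoly.

Set Implicit Arguments.
Unset Strict Implicit.
Unset Printing Implicit Defensive.

Import GRing.Theory.
Local Open Scope ring_scope.
Local Open Scope classical_set_scope.

(* Conventions. The base field K is algebraically closed (hence infinite), so  *)
(* polynomials on a vector space are identified with polynomial functions.     *)
(* W = K^N is 'cV[K]_N, its dual W^* is 'rV[K]_N (h is the form w |-> h *m w), *)
(* and S^d W^* is dhomog N K d, the space of d-homogeneous {mpoly K[N]}.       *)
(* A point of the projective space P(V) is represented by any nonzero vector   *)
(* of V on the line, so a subset of P(V) is a set of nonzero vectors of V.     *)

Section ProjectiveVarieties.
Variables (K : closedFieldType) (V : lmodType K).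
Implicit Types (X Y Z : set V) (m k : nat).

(* phi lies in Sym^m(V^* ): an m-homogeneous polynomial in linear forms. *)
Definition homog_polyfun m (phi : V -> K) : Prop :=
  exists (n : nat) (l : 'I_n -> {linear V -> K^o}) (p : {mpoly K[n]}),
    p \is m.-homog /\ forall v, phi v = p.@[fun i => l i v].

Definition proj_closure X : set V :=
  [set v | v != 0 /\ forall m (phi : V -> K), homog_polyfun m phi ->
     (forall w, X w -> phi w = 0) -> phi v = 0].

Definition proj_closed X : Prop := proj_closure X = X.

Definition proj_irreducible X : Prop :=
  [/\ proj_closed X, X !=set0 &
      forall Y Z, proj_closed Y -> proj_closed Z -> X `<=` Y `|` Z ->
        X `<=` Y \/ X `<=` Z].

Definition irreducible_component X Y : Prop :=
  [/\ proj_irreducible Y, Y `<=` X &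
      forall Z, proj_irreducible Z -> Y `<=` Z -> Z `<=` X -> Z = Y].

(* For Y irreducible: the function field of Y has transcendence degree at most *)
(* k over K, i.e. any k + 1 rational functions A_i / B_i on Y (A_i and B_i of  *)
(* the same degree, B_i not identically zero on Y) are algebraically dependent *)
(* over K.                                                                     *)
Definition function_field_trdeg_le Y k : Prop :=
  forall (m : 'I_k.+1 -> nat) (A B : 'I_k.+1 -> V -> K),
    (forall i, [/\ homog_polyfun (m i) (A i), homog_polyfun (m i) (B i) &
                   exists2 y, Y y & B i y != 0]) ->
    exists2 F : {mpoly K[k.+1]}, F != 0 &
      forall y, Y y -> (forall i, B i y != 0) ->
        F.@[fun i => A i y / B i y] = 0.

Definition proj_dim_le X k : Prop :=
  forall Y, irreducible_component X Y -> function_field_trdeg_le Y k.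

End ProjectiveVarieties.

Section DualVarieties.
Variables (K : closedFieldType) (N : nat).
Implicit Types (P : {mpoly K[N]}) (x : 'cV[K]_N).

Definition irreducible_mpoly P : Prop :=
  [/\ P != 0, P \isn't a GRing.unit &
      forall A B : {mpoly K[N]},
        P = A * B -> A \is a GRing.unit \/ B \is a GRing.unit].

Definition evalW P x : K := P.@[fun i => x i 0].

Definition gradient P x : 'rV[K]_N := \row_i evalW P^`M(i) x.

(* At a smooth point x of Z(P), the tangent hyperplane is the kernel of the    *)
(* differential of P at x.                                                     *)
Definition tangent_hyperplanes P : set 'rV[K]_N :=
  [set h | exists x (c : K),
     [/\ x != 0, evalW P x = 0, gradient P x != 0, c != 0 &
         h = c *: gradient P x]].

Definition dual_variety P : set 'rV[K]_N :=
  proj_closure (tangent_hyperplanes P).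

Definition Dual (k d : nat) : set (dhomog N K d) :=
  proj_closure [set P : dhomog N K d |
    irreducible_mpoly P /\ proj_dim_le (dual_variety P) k].

End DualVarieties.
Arguments Dual : clear implicits.

Section Equations.
Variables (K : closedFieldType) (N : nat).
Implicit Types (P : {mpoly K[N]}) (u v w : 'cV[K]_N).

Definition dirderiv w P : {mpoly K[N]} := \sum_(i < N) w i 0 *: P^`M(i).

Definition hess_det n (f : n.-tuple 'cV[K]_N) P : {mpoly K[N]} :=
  \det (\matrix_(i < n, j < n) dirderiv (tnth f i) (dirderiv (tnth f j) P)).

Definition line_restr u v P : {mpoly K[2]} :=
  P \mPo [tuple u i 0 *: 'X_(0 : 'I_2) + v i 0 *: 'X_(1 : 'I_2) | i < N].

(* The coefficient of x^a y^b in P(xu + yv). *)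
Definition line_coef u v P (a b : nat) : K :=
  (line_restr u v P)@_(U_(0%R : 'I_2) *+ a + U_(1%R : 'I_2) *+ b)%MM.

(* In the sum over r and (j_1, ..., j_r), the constraints j_s >= 1 and         *)
(* j_1 + ... + j_r = i - d + 1 force r <= i - d + 1. The latter is written     *)
(* i.+1 - d because subtraction on nat is truncated.                           *)
Definition Efun k d (f : (k + 3).-tuple 'cV[K]_N) u v (P : dhomog N K d) : K :=
  let e := ((k + 3) * (d - 2))%N in
  let p j := line_coef u v P j (d - j) in
  let q i := line_coef u v (hess_det f P) i (e - i) in
  \sum_(d.-1 <= i < e.+1) \sum_(r < (i.+1 - d).+1)
    \sum_(j : {ffun 'I_r -> 'I_d.+1} |
            [forall s, 0 < j s]%N && (\sum_s j s == i.+1 - d)%N)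
      (-1) ^+ r * q i * (\prod_s p (d - j s)%N) * p d ^+ (e.+1 - d - r).

Definition Eset k d : set (dhomog N K d -> K) :=
  [set phi | exists (f : (k + 3).-tuple 'cV[K]_N) u v,
     [/\ free f, u \in <<f>>%VS, v \in <<f>>%VS, free [:: u; v] &
         phi = Efun f u v]].

End Equations.
Arguments Eset : clear implicits.

Section Modules.
Variables (K : closedFieldType) (N d : nat).
Implicit Types (g : 'M[K]_N) (P : dhomog N K d) (phi psi : dhomog N K d -> K).
Implicit Types (M L : set (dhomog N K d -> K)).

Definition lin_subst g : N.-tuple {mpoly K[N]} :=
  [tuple \sum_(j < N) g i j *: 'X_j | i < N].

Lemma pullback_homog g P : (P : {mpoly K[N]}) \mPo lin_subst g \is d.-homog.
Proof.
have /dhomogP hP := dhomog_is_dhomog P.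
rewrite comp_mpolyE big_seq; apply: rpred_sum => m /hP /= dm; apply: rpredZ.
have -> : d = (\sum_(i < N) 1 * m i)%N.
  by rewrite -dm mdegE; apply: eq_bigr => i _; rewrite mul1n.
elim/big_ind2: _ => [|p a q b hp hq|i _]; first exact: dhomog1.
  exact: dhomogM.
apply: dhomogMn; rewrite tnth_mktuple; apply: rpred_sum => j _.
by apply: rpredZ; rewrite dhomogX /= mdeg1.
Qed.

(* P o g, where g acts on W by w |-> g *m w. *)
Definition pullback g P : dhomog N K d := DHomog (pullback_homog g P).

(* The left action of g on polynomials on S^d W^*, i.e. on Sym(S^d W):         *)
(* (g phi)(P) = phi(g^-1 P), with g^-1 P = P o g.                              *)
Definition act g phi : dhomog N K d -> K := fun P => phi (pullback g P).

Definition span_fun M : set (dhomog N K d -> K) :=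
  [set phi | exists (n : nat) (c : 'I_n -> K) (s : 'I_n -> dhomog N K d -> K),
     (forall i, M (s i)) /\ phi = fun P => \sum_(i < n) c i * s i P].

Definition SL_submodule M : Prop :=
  [/\ M (fun=> 0),
      forall (a b : K) phi psi, M phi -> M psi ->
        M (fun P => a * phi P + b * psi P) &
      forall g phi, \det g = 1 -> M phi -> M (act g phi)].

Definition SL_irreducible M : Prop :=
  [/\ SL_submodule M, M <> [set (fun=> 0)] &
      forall L, SL_submodule L -> L `<=` M -> L = [set (fun=> 0)] \/ L = M].

(* Weights are written multiplicatively, as characters of the Borel subgroup   *)
(* of upper triangular matrices b of SL_N, trivial on its unipotent radical.   *)
(* The i-th fundamental weight is b |-> b_11 ... b_ii, the weight of the       *)
(* highest weight vector e_1 /\ ... /\ e_i of Lambda^i W.                      *)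
Definition fund_weight i g : K := \prod_(j < N | (j < i)%N) g j j.

Definition highest_weight_vector (chi : 'M[K]_N -> K) phi : Prop :=
  phi <> (fun=> 0) /\
  forall b, is_trig_mx b^T -> \det b = 1 -> act b phi = fun P => chi b * phi P.

(* An irreducible (rational) SL_N-module is determined up to isomorphism by    *)
(* the weight of its highest weight vector.                                    *)
Definition irreducible_of_highest_weight (chi : 'M[K]_N -> K) M : Prop :=
  SL_irreducible M /\ exists2 phi, M phi & highest_weight_vector chi phi.

End Modules.

(* No truncation occurs in the exponents when d >= 3. *)
Definition Omega (K : closedFieldType) (N k d : nat) (b : 'M[K]_N) : K :=
  fund_weight 1 b ^+ ((d - 1) * (d - 2) * (k + 2))
  * fund_weight 2 b ^+ (d * (k + 2) - 2 * k - 5)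
  * fund_weight (k + 3) b ^+ 2.
Arguments Omega : clear implicits.

(* Main.v *)
(* Segre's argument gives the vanishing. If [P] is irreducible and its dual
   variety has dimension at most k, any k+1 ratios of the derivatives
   [d_(f_i) P] are algebraically dependent modulo [P]; differentiating such
   relations, one omitting each [f_j], forces [det H] (H the Hessian along F) to
   vanish modulo [P]. Hence [P] divides [Q_f], and [E] is a coefficient of the
   product of (reversed) [Q_f] with the truncated inverse series of (reversed)
   [P], so it kills the multiples of [P].

   For the module, [E] is the top coefficient of a Euclidean remainder, so
   it only depends on the flag up to scale; it is thus a highest weight vector
   for the standard flag, and its SL_N-orbit spans. The polynomial functions on
   [S^d W^*] carry a Hermitian (Fischer) form in which the adjoint of g is its
   conjugate transpose. For a submodule L, the orthogonal projection of the
   highest weight vector to L is again a highest weight vector of the same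
   weight, hence a multiple of it: its defect from being one is orthogonal to
   the orbit of the big cell, hence to the span. So L is 0 or everything. *)
Require Import Defs.
From HB Require Import structures.
From mathcomp Require Import all_boot all_order all_algebra.
From mathcomp Require Import boolp classical_sets reals complex mpoly.
From mathcomp Require Import perm ring zify.
From mathcomp Require ssrcomplements.

Set Implicit Arguments.
Unset Strict Implicit.
Unset Printing Implicit Defensive.

Import Order.TTheory GRing.Theory Num.Theory.
Local Open Scope ring_scope.
Local Open Scope classical_set_scope.

(** * Gauss's lemma *)
Section Factoriality.

(** The hypothesis on the dual variety concerns values at points, while the argument needs
    divisibility by P. The bridge is the Nullstellensatz for one irreducible hypersurface; it and
    the primality of irreducible polynomials are proved by induction on the number of variables,
    where pseudo-division leaves scalar factors to be stripped off. Only smooth points of Z(P) yield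
    tangent hyperplanes; they suffice because P fails to divide one of its partial derivatives.
    Since dimension is measured on irreducible components, the dual variety must itself be shown
    irreducible. The number k+3 is forced: omitting one direction leaves k+2 derivatives, whose
    ratios to the last are k+1 rational functions. The Hermitian form takes the place of complete
    reducibility and of weight theory. It works because SL_N is stable under conjugate transpose,
    which exchanges the lower and upper triangular groups. Density of the big cell is used in an
    algebraic form: for any matrix g, [g + s] has an LU factorization for all but finitely many
    scalars s, and the quantities at stake are polynomial in s. *)

Definition irreducible_elt (R : idomainType) (x : R) : Prop :=
  [/\ x != 0, x \isn't a GRing.unit &
      forall a b, x = a * b -> a \is a GRing.unit \/ b \is a GRing.unit].

Definition divides (R : idomainType) (x y : R) : Prop := exists z, y = z * x.

Definition prime_elt (R : idomainType) (x : R) : Prop :=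
  forall a b, divides x (a * b) -> divides x a \/ divides x b.

Lemma divides_mull (R : idomainType) (x y z : R) :
  divides x y -> divides x (z * y).
Proof. by case=> t ->; exists (z * t); rewrite mulrA. Qed.

Lemma divides_sum (R : idomainType) (x : R) (I : finType) (P : pred I)
    (F : I -> R) :
  (forall i, P i -> divides x (F i)) -> divides x (\sum_(i | P i) F i).
Proof.
move=> h; elim/big_ind: _ => //; first by exists 0; rewrite mul0r.
by move=> _ _ [u ->] [v ->]; exists (u + v); rewrite mulrDl.
Qed.

Lemma divides_sub (R : idomainType) (x a b : R) :
  divides x a -> divides x b -> divides x (a - b).
Proof. by move=> [u ->] [v ->]; exists (u - v); rewrite mulrBl. Qed.

Lemma divides_polyC (R : idomainType) (a : R) (p : {poly R}) :
  (forall i, divides a p`_i) -> divides a%:P p.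
Proof.
move=> h; pose c i := xget 0 [set z | p`_i = z * a].
have hc i : p`_i = c i * a.
  by rewrite /c; case: xgetP => [_ -> //|]; case: (h i) => z hz /(_ z).
exists (\poly_(i < size p) c i); apply/polyP=> i.
rewrite coefMC coef_poly; case: ltnP => hi; first exact: hc.
by rewrite mul0r nth_default.
Qed.

(** Let i and j be the least indices at which the coefficients of p and q escape a. In the
    coefficient of X^(i+j) of the product every other term is divisible by a, hence so is the
    product of these two coefficients. *)
Lemma prime_polyC (R : idomainType) (a : R) :
  prime_elt a -> prime_elt a%:P.
Proof.
move=> pa p q [s pqs].
have hs i : divides a (p * q)`_i by rewrite pqs coefMC; exists s`_i.
have [hp|/existsNP [i0 hi0]] := pselect (forall i, divides a p`_i).
  by left; apply: divides_polyC.
have [hq|/existsNP [j0 hj0]] := pselect (forall i, divides a q`_i).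
  by right; apply: divides_polyC.
exfalso.
have /ex_minnP [i /asboolP hi mi] : exists i, `[< ~ divides a p`_i >].
  by exists i0; apply/asboolP.
have /ex_minnP [j /asboolP hj mj] : exists j, `[< ~ divides a q`_j >].
  by exists j0; apply/asboolP.
have {}mi l : (l < i)%N -> divides a p`_l.
  by move=> hl; apply: contrapT => /asboolP /mi; rewrite leqNgt hl.
have {}mj l : (l < j)%N -> divides a q`_l.
  by move=> hl; apply: contrapT => /asboolP /mj; rewrite leqNgt hl.
have := hs (i + j)%N; rewrite coefM.
have hij : (i < (i + j).+1)%N by rewrite ltnS leq_addr.
rewrite (bigD1 (Ordinal hij)) //= addKn => h.
have : divides a (p`_i * q`_j).
  rewrite -[p`_i * _](addrK (\sum_(l < (i + j).+1 | l != Ordinal hij)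
    p`_l * q`_(i + j - l))).
  apply: divides_sub h _; apply: divides_sum => l hl.
  have [lti|gti|eqi] := ltngtP l i.
  - by rewrite mulrC; apply: divides_mull; apply: mi.
  - by apply: divides_mull; apply: mj; have := ltn_ord l; lia.
  - by case/eqP: hl; apply: val_inj.
by case/pa.
Qed.

Lemma irreducible_polyC (R : idomainType) (a : R) :
  irreducible_elt a%:P -> irreducible_elt a.
Proof.
case=> a0 ua irra; split; first by rewrite -polyC_eq0.
  by apply: contra ua => u; rewrite poly_unitE size_polyC coefC -polyC_eq0 a0.
move=> b c e; have := irra b%:P c%:P.
by rewrite -polyCM -e !poly_unitE !coefC => /(_ erefl) [] /andP [_]; [left|right].
Qed.

(** * Irreducible polynomials are prime when irreducible coefficients are *)

Section GaussLemma.
Variables (R : idomainType) (mu : R -> nat).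
Hypothesis muM : forall a b, a != 0 -> b != 0 -> mu (a * b) = (mu a + mu b)%N.
Hypothesis mu_unit : forall a, a != 0 -> (mu a == 0%N) = (a \is a GRing.unit).
Hypothesis irr_prime : forall a : R, irreducible_elt a -> prime_elt a.

(** The additive [mu], zero exactly on units, plays the part of a degree: a proper factorization
    lowers it on both factors, so the splitting terminates. *)
Lemma irreducible_factor (a : R) : a != 0 -> a \isn't a GRing.unit ->
  exists p b, irreducible_elt p /\ a = p * b.
Proof.
have [n] := ubnP (mu a); elim: n a => // n IH a hn a0 ua.
have [irr|/existsNP [b /existsNP [c /not_implyP [abc /not_orP [ub uc]]]]] :=
  pselect (forall b c, a = b * c -> b \is a GRing.unit \/ c \is a GRing.unit).
  by exists a, 1; rewrite mulr1.
have [b0 c0] : b != 0 /\ c != 0.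
  by apply/andP; rewrite -negb_or -mulf_eq0 -abc.
have hb : (0 < mu b)%N by rewrite lt0n mu_unit //; apply/negP.
have hc : (0 < mu c)%N by rewrite lt0n mu_unit //; apply/negP.
have [|||p [e [ip be]]] := IH b => //; last 1 first.
- by exists p, (e * c); split=> //; rewrite abc be mulrA.
- by move: hn; rewrite abc muM //; lia.
- exact/negP.
Qed.

(** Induction on the irreducible factors of a nonzero scalar, used below to clear the denominators
    produced by pseudo-division. *)
Lemma scale_ind (Q : R -> Prop) :
  (forall c, c \is a GRing.unit -> Q c) ->
  (forall p c, c != 0 -> irreducible_elt p -> Q c -> Q (p * c)) ->
  forall c, c != 0 -> Q c.
Proof.
move=> hu hp c; have [n] := ubnP (mu c); elim: n c => // n IH c hn c0.
have [/hu //|uc] := boolP (c \is a GRing.unit).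
have [p [b [ip e]]] := irreducible_factor c0 uc.
have b0 : b != 0 by apply: contraNneq c0 => b0; rewrite e b0 mulr0.
have [p0 up _] := ip.
have mp : (0 < mu p)%N by rewrite lt0n mu_unit.
rewrite e; apply: hp => //; apply: IH => //.
by move: hn; rewrite e muM //; lia.
Qed.

Lemma scale_eq_mul_irr (p c : R) (A S T : {poly R}) :
  p != 0 -> (p * c) *: A = p%:P * S * T -> c *: A = S * T.
Proof.
move=> p0; rewrite -scalerA -mulrA -mul_polyC => /mulfI; apply.
by rewrite polyC_eq0.
Qed.

(** An irreducible factor p of c is prime also as a constant polynomial, so it divides the cofactor
    S, where it cancels, or P. The latter is excluded since P is irreducible of positive degree. *)
Lemma divides_scale (P : {poly R}) : irreducible_elt P -> (1 < size P)%N ->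
  forall c, c != 0 -> forall H, divides P (c *: H) -> divides P H.
Proof.
move=> [P0 uP irrP] sP; apply: scale_ind => [c uc H [S e]|].
  by exists (c^-1 *: S); rewrite -scalerAl -e scalerA mulVr // scale1r.
move=> p c c0 ip IH H [S e].
have [p0 up _] := ip.
have /prime_polyC/(_ S P) := irr_prime ip.
case; first by exists (c *: H); rewrite -e [RHS]mulrC mul_polyC scalerA.
  by case=> S' eS; apply: IH; exists S'; apply: (@scale_eq_mul_irr p);
     rewrite // e eS (mulrC S').
case=> P' eP; case: (irrP _ _ eP) => [uP'|].
  by move/andP: uP' => [/eqP h _]; move: sP; rewrite eP mulrC mul_polyC size_scale ?h.
by rewrite poly_unitE coefC size_polyC p0 (negPf up).
Qed.

(** In effect P stays irreducible over the fraction field: each irreducible factor of c is absorbed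
    by D or by S without changing their degrees. *)
Lemma divisor_scale_const (P : {poly R}) : irreducible_elt P ->
  forall c, c != 0 -> forall D S, c *: P = D * S -> (1 < size D)%N ->
    (size S <= 1)%N.
Proof.
move=> [P0 uP irrP]; apply: scale_ind => [c uc D S e sD|].
  have: P = (c^-1 *: D) * S by rewrite -scalerAl -e scalerA mulVr // scale1r.
  case/irrP => /andP [/eqP h _]; last by rewrite h.
  by move: h sD; rewrite size_scale => [->//|]; rewrite -unitrV in uc;
     apply: contraTneq uc => ->; rewrite unitr0.
move=> p c c0 ip IH D S e sD.
have [p0 up _] := ip.
have /prime_polyC/(_ D S) := irr_prime ip.
case; first by exists (c *: P); rewrite -e [RHS]mulrC mul_polyC scalerA.
  case=> D' eD; have sD' : size D' = size D.
    by rewrite eD mulrC mul_polyC size_scale.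
  apply: (IH D'); last by rewrite sD'.
  by apply: (scale_eq_mul_irr p0); rewrite e eD (mulrC D').
case=> S' eS; rewrite eS mulrC mul_polyC size_scale //.
apply: (IH D) => //; rewrite mulrC.
by apply: (scale_eq_mul_irr p0); rewrite e eS; ring.
Qed.

(** For P of positive degree, compare it with G over the fraction field. If they are coprime, P
    divides a scalar multiple of H; otherwise their gcd is P up to scalars, so P divides a scalar
    multiple of G. The scalars are then removed by [divides_scale]. *)
Lemma irreducible_prime_poly (P : {poly R}) :
  irreducible_elt P -> prime_elt P.
Proof.
move=> iP G H PGH; have [P0 uP irrP] := iP.
have [sP|sP] := leqP (size P) 1.
  have [p eP] : exists p, P = p%:P by exists P`_0; exact: size1_polyC.
  move: iP PGH; rewrite eP => /irreducible_polyC ip.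
  by apply: prime_polyC; exact: irr_prime.
have [cop|ncop] := boolP (coprimep P G).
  right; have: P %| G * H.
    by case: PGH => z ->; apply: Pdiv.Idomain.dvdp_mull.
  rewrite Pdiv.Idomain.Gauss_dvdpr // => /Pdiv.Idomain.dvdpP [[a q] /= a0 e].
  by apply: (divides_scale iP sP a0); exists q.
left; move: ncop; set D := gcdp P G.
have D0 : D != 0 by rewrite Pdiv.Idomain.gcdp_eq0 negb_and P0.
rewrite Pdiv.Idomain.coprimep_def -/D => sD.
have {}sD : (1 < size D)%N.
  by move: sD D0; rewrite -size_poly_eq0; case: size => [|[]].
have /Pdiv.Idomain.dvdpP [[a q] /= a0 e] := Pdiv.Idomain.dvdp_gcdl P G.
have /Pdiv.Idomain.dvdpP [[b t] /= b0 e'] := Pdiv.Idomain.dvdp_gcdr P G.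
rewrite -/D in e e'.
have sq : (size q <= 1)%N.
  by apply: (divisor_scale_const iP a0 (D := D)); rewrite // mulrC.
have q0 : q != 0.
  apply: contra_neq P0 => q0; apply/eqP; move: e; rewrite q0 mul0r => /eqP.
  by rewrite -mul_polyC mulf_eq0 polyC_eq0 (negPf a0).
have eq := size1_polyC sq.
have q00 : q`_0 != 0 by rewrite -polyC_eq0 -eq.
apply: (divides_scale iP sP (c := q`_0 * b)); first exact: mulf_neq0.
exists (a *: t).
by rewrite -scalerA e' -mul_polyC -eq mulrCA -e -!mul_polyC; ring.
Qed.

End GaussLemma.

Lemma irreducible_bij (R S : idomainType) (f : R -> S) (g : S -> R) :
  cancel f g -> cancel g f -> {morph f : x y / x * y} -> f 1 = 1 -> f 0 = 0 ->
  forall x, irreducible_elt x -> irreducible_elt (f x).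
Proof.
move=> fK gK fM f1 f0.
have gM : {morph g : x y / x * y}.
  by move=> a b; apply: (can_inj fK); rewrite fM !gK.
have g1 : g 1 = 1 by rewrite -f1 fK.
have unitf y : (f y \is a GRing.unit) = (y \is a GRing.unit).
  apply/unitrP/unitrP => -[z [h1 h2]].
    by exists (g z); split; apply: (can_inj fK); rewrite fM gK f1.
  by exists (f z); rewrite -!fM h1 h2 f1.
move=> x [x0 ux ix]; split; first by rewrite -f0 (can_eq fK).
  by rewrite unitf.
move=> a b e; have := ix (g a) (g b).
by rewrite -gM -e fK -!unitf !gK; apply.
Qed.

End Factoriality.

(** * Hypersurface Nullstellensatz *)

Section MpolyFactoriality.

Lemma muniX n (R : nzRingType) (m : 'X_{1..n.+1}) :
  muni ('X_[m] : {mpoly R[n.+1]}) =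
  'X_[[multinom m (widen_ord (leqnSn n) i) | i < n]] *: 'X^(m ord_max).
Proof. by rewrite muniE msuppX big_seq1 mcoeffX eqxx scale1r. Qed.

Lemma muni_mwiden n (R : nzRingType) (c : {mpoly R[n]}) :
  muni (mwiden c) = c%:P.
Proof.
elim/mpolyind: c => [|a m p _ _ IH]; first by rewrite mwiden0 muni0.
rewrite mwidenD muniD IH mwidenZ muniZ mwidenX muniX mnmwiden_ordmax expr0.
rewrite polyCD; congr (_ + _); rewrite scalerA alg_polyC mul_mpolyC.
congr (_ *: 'X_[_])%:P; apply/mnmP=> i.
by rewrite mnmE mnmwiden_widen.
Qed.

Lemma widen_ord_lift n (i : 'I_n) : widen_ord (leqnSn n) i = lift ord_max i.
Proof. by apply: val_inj; rewrite /= /bump leqNgt ltn_ord. Qed.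

(** The inverse of [muni]: the last variable is substituted for the indeterminate. *)
Definition unmuni n (R : comNzRingType) :
    {poly {mpoly R[n]}} -> {mpoly R[n.+1]} :=
  horner_eval 'X_ord_max \o map_poly (@mwiden n R).

HB.instance Definition _ n (R : comNzRingType) :=
  GRing.RMorphism.on (@unmuni n R).

Lemma unmuniD n (R : comNzRingType) : {morph @unmuni n R : p q / p + q}.
Proof. exact: rmorphD. Qed.

Lemma unmuniM n (R : comNzRingType) : {morph @unmuni n R : p q / p * q}.
Proof. exact: rmorphM. Qed.

Lemma unmuni0 n (R : comNzRingType) : @unmuni n R 0 = 0.
Proof. exact: rmorph0. Qed.

Lemma unmuni_exp n (R : comNzRingType) k :
  {morph @unmuni n R : p / p ^+ k}.
Proof. exact: rmorphXn. Qed.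

Lemma unmuniC n (R : comNzRingType) (c : {mpoly R[n]}) :
  unmuni c%:P = mwiden c.
Proof. by rewrite /unmuni /= map_polyC /= /horner_eval hornerC. Qed.

Lemma unmuni_X n (R : comNzRingType) :
  unmuni ('X : {poly {mpoly R[n]}}) = 'X_ord_max.
Proof. by rewrite /unmuni /= map_polyX /horner_eval hornerX. Qed.

Lemma unmuniK n (R : comNzRingType) : cancel (@unmuni n R) (@muni n R).
Proof.
move=> q; elim/poly_ind: q => [|q c IH]; first by rewrite unmuni0 muni0.
rewrite unmuniD unmuniM muniD muniM IH unmuni_X unmuniC muni_mwiden.
congr (_ * _ + _); rewrite muniX mnm1E eqxx expr1.
set m := [multinom _ | _ < _].
suff -> : m = 0%MM by rewrite mpolyX0 scale1r.
apply/mnmP=> i; rewrite /m mnmE mnm1E mnm0E.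
by case: eqP => // /(congr1 val) /= /eqP; rewrite gtn_eqF.
Qed.

Lemma muniK n (R : comNzRingType) : cancel (@muni n R) (@unmuni n R).
Proof.
move=> p; elim/mpolyind: p => [|a m p _ _ IH]; first by rewrite muni0 unmuni0.
rewrite muniD unmuniD; congr (_ + _); last exact: IH.
rewrite muniZ muniX -!mul_polyC !unmuniM !unmuniC unmuni_exp unmuni_X.
rewrite mwidenC mul_mpolyC; congr (_ *: _).
rewrite mwidenX mpolyXn -mpolyXD; congr 'X_[_]; apply/mnmP=> i.
rewrite mnmDE mulmnE mnm1E; case: (unliftP ord_max i) => [j|] ->.
  rewrite (negPf (neq_lift _ _)) addn0.
  by rewrite -widen_ord_lift mnmwiden_widen mnmE.
by rewrite eqxx mnmwiden_ordmax mul1n.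
Qed.

Lemma meval_unmuni n (R : comNzRingType) (x : 'I_n.+1 -> R)
    (q : {poly {mpoly R[n]}}) :
  (unmuni q).@[x] =
  (map_poly (meval (x \o widen_ord (leqnSn n))) q).[x ord_max].
Proof.
elim/poly_ind: q => [|q c IH]; first by rewrite unmuni0 meval0 rmorph0 horner0.
rewrite unmuniD unmuniM mevalD mevalM !unmuniC unmuni_X IH mevalXU.
rewrite rmorphD rmorphM /=.
rewrite map_polyX map_polyC /= !hornerE; congr (_ * _ + _).
elim/mpolyind: c => [|a m p _ _ IHp]; first by rewrite mwiden0 !meval0.
rewrite mwidenD !mevalD IHp mwidenZ !mevalZ mwidenX !mevalX; congr (_ * _ + _).
rewrite big_ord_recr /= mnmwiden_ordmax expr0 mulr1; apply: eq_bigr => i _.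
by rewrite mnmwiden_widen.
Qed.

Lemma meval_extend (K : nzRingType) n (x : 'I_n -> K) (c : K) :
  exists y : 'I_n.+1 -> K,
    y ord_max = c /\ (y \o widen_ord (leqnSn n)) =1 x.
Proof.
exists (fun j => if unlift ord_max j is Some l then x l else c).
by rewrite unlift_none; split=> // l /=; rewrite widen_ord_lift liftK.
Qed.

Lemma poly_eq0_nat (K : numFieldType) (p : {poly K}) :
  (forall n : nat, p.[n%:R] = 0) -> p = 0.
Proof.
move=> h; apply/eqP; apply: contraT => p0.
have := max_poly_roots p0 (rs := [seq n%:R | n <- iota 0 (size p)]).
rewrite size_map size_iota ltnn => -> //.
  by apply/allP=> _ /mapP [n _ ->]; rewrite /root h.
rewrite map_inj_uniq ?iota_uniq // => a b /eqP.
by rewrite eqr_nat => /eqP.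
Qed.

Lemma mpoly_eq0_meval (K : numFieldType) n (p : {mpoly K[n]}) :
  (forall x, p.@[x] = 0) -> p = 0.
Proof.
elim: n p => [|n IH] p hp.
  by have := hp (fun=> 0); rewrite {1 2}(nvar0_mpolyC p) mevalC => ->.
apply: (can_inj (@muniK n K)); rewrite muni0; apply/polyP=> i; rewrite coef0.
apply: IH => x.
suff : map_poly (meval x) (muni p) = 0 by move/polyP/(_ i); rewrite coef_map coef0.
apply: poly_eq0_nat => k.
have [y [yk yx]] := meval_extend x k%:R.
have := hp y; rewrite -[p]muniK meval_unmuni unmuniK yk.
by rewrite (eq_map_poly (g := meval x)) // => q; apply: meval_eq.
Qed.

Lemma mpoly_unit_msize (K : fieldType) n (p : {mpoly K[n]}) : p != 0 ->
  ((msize p).-1 == 0%N) = (p \is a GRing.unit).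
Proof.
move=> p0; rewrite /GRing.unit /= /mpoly_unit.
apply/idP/andP => [/eqP hs|[/eqP e u]]; last first.
  by rewrite e msizeC; case: (_ != 0).
have e : p = (p@_0)%:MP by apply: msize1_polyC; move: hs; case: (mmeasure _ p) => [|[]].
split; first exact/eqP.
by rewrite unitfE; apply: contraNneq p0 => h; rewrite e h.
Qed.

(** The Nullstellensatz in one variable: p splits into deg p linear factors, each of which divides
    q. *)
Lemma dvdp_exp_roots (K : closedFieldType) (p q : {poly K}) : p != 0 ->
  (forall x, root p x -> root q x) -> p %| q ^+ (size p).-1.
Proof.
move=> p0 h; have [r e] := closed_field_poly_normal p.
have lc0 : lead_coef p != 0 by rewrite lead_coef_eq0.
rewrite {2}e size_scale // size_prod_XsubC /=.
rewrite {1}e dvdpZl //.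
have {}h x : x \in r -> root q x.
  by move=> xr; apply: h; rewrite e rootZ // root_prod_XsubC.
elim: r {e} h => [|x r IH] h; first by rewrite big_nil dvd1p.
rewrite big_cons exprS dvdp_mul ?IH //; last first.
  by move=> y yr; apply: h; rewrite inE yr orbT.
by rewrite dvdp_XsubCl h // inE eqxx.
Qed.

Definition hypersurface_null (K : numClosedFieldType) n : Prop :=
  forall P : {mpoly K[n]}, irreducible_elt P ->
  forall Q : {mpoly K[n]}, (forall x, P.@[x] = 0 -> Q.@[x] = 0) -> divides P Q.

(** The inductive step. For p of positive degree, pseudo-divide a power of q by p. Wherever the
    leading coefficient l of p does not vanish, specialization keeps the degree of p, so the
    specialized p divides the remainder r, which is too small and vanishes. Thus l r is zero
    everywhere, r = 0, and primality of p concludes, p being of larger degree than any power of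
    l. *)
Lemma divides_poly_null (K : numClosedFieldType) n
    (p q : {poly {mpoly K[n]}}) :
  hypersurface_null K n -> irreducible_elt p -> prime_elt p ->
  (forall (y : 'I_n -> K) x, root (map_poly (meval y) p) x ->
    root (map_poly (meval y) q) x) ->
  divides p q.
Proof.
move=> IH ip pp h.
have [p0 up irp] := ip.
have [sp|sp] := leqP (size p) 1.
  have [a ea] : exists a, p = a%:P by exists p`_0; exact: size1_polyC.
  have ia : irreducible_elt a by apply: irreducible_polyC; rewrite -ea.
  rewrite ea; apply: divides_polyC => i; apply: (IH a ia) => y ay.
  (* Where a vanishes, the specialized p is zero, so every scalar is a root of it and hence of the
     specialized q. *)
  have : map_poly (meval y) q = 0.
    apply: poly_eq0_nat => k; apply/eqP; apply: h.
    by rewrite ea map_polyC /= ay root0.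
  by move/polyP/(_ i); rewrite coef_map coef0.
set l := lead_coef p; have l0 : l != 0 by rewrite lead_coef_eq0.
pose Q := q ^+ (size p).-1.
have eQ := Pdiv.Idomain.divp_eq Q p.
set r := Q %% p in eQ; set s := Q %/ p in eQ.
have sr : (size r < size p)%N by rewrite Pdiv.Idomain.ltn_modp.
have r0 : l *: r = 0.
  apply/polyP=> i; rewrite coefZ coef0; apply: mpoly_eq0_meval => y.
  rewrite mevalM; have [->|ly] := eqVneq (l.@[y]) 0; first by rewrite mul0r.
  have sz : size (map_poly (meval y) p) = size p by rewrite size_map_poly_id0.
  have : map_poly (meval y) p %| map_poly (meval y) r.
    have -> : r = l ^+ scalp Q p *: Q - s * p by rewrite eQ addrAC subrr add0r.
    rewrite rmorphB rmorphM /= dvdp_sub ?dvdp_mull //.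
    rewrite -mul_polyC rmorphM /= dvdp_mull // /Q rmorphXn /= -sz.
    apply: dvdp_exp_roots; last exact: h.
    by rewrite -size_poly_eq0 sz size_poly_eq0.
  have [/polyP/(_ i) + _|mr0 /dvdp_leq] := eqVneq (map_poly (meval y) r) 0.
    by rewrite coef_map coef0 => ->; rewrite mulr0.
  rewrite mr0 sz leqNgt (leq_ltn_trans _ sr) // => [/(_ isT)//|].
  exact: size_poly.
have {}r0 : r = 0.
  by apply/eqP; move/eqP: r0; rewrite -mul_polyC mulf_eq0 polyC_eq0 (negPf l0).
have : divides p ((l ^+ scalp Q p)%:P * Q).
  by exists s; rewrite mul_polyC eQ r0 addr0.
case/pp=> [[t e]|].
  have /eqP := congr1 (fun u : {poly _} => size u) e.
  have lk0 : l ^+ scalp Q p != 0 by rewrite expf_neq0.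
  have t0 : t != 0 by apply: contra_neq lk0 => t0; apply/eqP;
     rewrite -polyC_eq0 e t0 mul0r.
  rewrite size_polyC lk0 size_mul //.
  move: t0 sp; rewrite -size_poly_gt0.
  case: (size t) => [|a] //; case: (size p) => [|[|b]] // _ _.
  by rewrite addSn !addnS.
rewrite /Q; elim: _.-1 => [|k IHk]; last by rewrite exprS => /pp [|/IHk].
case=> t /esym e; case/negP: up; apply/unitrP; exists t; rewrite [p * t]mulrC.
by rewrite e expr0.
Qed.

Lemma prime_muni (K : fieldType) n (P : {mpoly K[n.+1]}) :
  (forall a : {mpoly K[n]}, irreducible_elt a -> prime_elt a) ->
  irreducible_elt P -> irreducible_elt (muni P) /\ prime_elt (muni P).
Proof.
move=> IH iP.
have imP : irreducible_elt (muni P).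
  exact: (irreducible_bij (@muniK n K) (@unmuniK n K) (@muniM n K)
            (@muni1 n K) (@muni0 n K) iP).
split; [exact: imP|].
(* The measure is the total degree, additive and zero exactly on nonzero constants. *)
apply: (@irreducible_prime_poly _ (fun p => (msize p).-1)) imP.
- move=> a b a0 b0; rewrite msizeM //.
  by rewrite (mpolySpred _ a0) (mpolySpred _ b0) /=; lia.
- by move=> a a0; apply: mpoly_unit_msize.
- exact: IH.
Qed.

Lemma divides_muni (K : fieldType) n (P Q : {mpoly K[n.+1]}) :
  divides (muni P) (muni Q) -> divides P Q.
Proof.
case=> S e; exists (unmuni S); apply: (can_inj (@muniK n K)).
by rewrite muniM unmuniK.
Qed.

Lemma irreducible_mpoly_prime (K : fieldType) n (P : {mpoly K[n]}) :
  irreducible_elt P -> prime_elt P.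
Proof.
elim: n P => [|n IH] P iP.
  have [P0 /negP[]] := iP; rewrite -mpoly_unit_msize //.
  by rewrite (nvar0_mpolyC P) msizeC; case: (_ != 0).
have [_ pmP] := prime_muni IH iP.
move=> A B [S e].
have : divides (muni P) (muni A * muni B).
  by exists (muni S); move/(congr1 (@muni n K)): e; rewrite 2!muniM.
by case/pmP => /divides_muni; [left|right].
Qed.

Lemma hypersurface_nullstellensatz (K : numClosedFieldType) n :
  hypersurface_null K n.
Proof.
elim: n => [|n IH] P iP Q hQ.
  have [P0 /negP[]] := iP; rewrite -mpoly_unit_msize //.
  by rewrite (nvar0_mpolyC P) msizeC; case: (_ != 0).
have [imP pmP] := prime_muni (@irreducible_mpoly_prime K n) iP.
apply: divides_muni; apply: (divides_poly_null IH imP pmP) => y x.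
have [z [<- zy]] := meval_extend y x.
have ez (r : {mpoly K[n.+1]}) :
    (map_poly (meval y) (muni r)).[z ord_max] = r.@[z].
  rewrite -[r in RHS]muniK meval_unmuni; congr (_.[_]).
  by apply: eq_map_poly => a; apply: meval_eq => i; rewrite zy.
by move/eqP; rewrite (ez P) => /hQ hz; apply/eqP; rewrite (ez Q).
Qed.

End MpolyFactoriality.

(** * Relations between derivatives *)

Lemma submm n (m : 'X_{1..n}) : (m - m = 0)%MM.
Proof. by apply/mnmP=> i; rewrite mnmBE subnn mnm0E. Qed.

Section Derivations.
Variables (R : comNzRingType).

Lemma mpoly_alg_ind n (Q : {mpoly R[n]} -> Prop) :
  (forall c, Q c%:MP) -> (forall i, Q 'X_i) ->
  (forall p q, Q p -> Q q -> Q (p + q)) ->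
  (forall p q, Q p -> Q q -> Q (p * q)) -> forall p, Q p.
Proof.
move=> hC hX hD hM p; rewrite [p]mpolyE.
elim/big_ind: _ => [||m _]; [by rewrite -mpolyC0 | exact: hD |].
rewrite -mul_mpolyC; apply: (hM) => //; rewrite mpolyXE_id.
elim/big_ind: _ => [||i _]; [by rewrite -mpolyC1 | exact: hM |].
by elim: (m i) => [|k IH]; rewrite ?expr0 -?mpolyC1 // exprS; apply: hM.
Qed.

Lemma mderiv_comp n k (p : {mpoly R[n]}) (t : n.-tuple {mpoly R[k]}) j :
  (p \mPo t)^`M(j) = \sum_(i < n) (p^`M(i) \mPo t) * (tnth t i)^`M(j).
Proof.
elim/mpoly_alg_ind: p => [c|l|p q hp hq|p q hp hq].
- rewrite comp_mpolyC mderivC big1 // => i _.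
  by rewrite mderivC comp_mpoly0 mul0r.
- rewrite comp_mpolyXU (bigD1 l) //= big1 => [|i il].
    rewrite addr0 mderivX mnm1E eqxx scale1r -(tnth_nth 0).
    by rewrite submm mpolyX0 comp_mpoly1 mul1r.
  by rewrite mderivX mnm1E eq_sym (negPf il) scale0r comp_mpoly0 mul0r.
- rewrite rmorphD mderivD hp hq -big_split; apply: eq_bigr => i _ /=.
  by rewrite mderivD rmorphD mulrDl.
- rewrite rmorphM /= mderivM hp hq mulr_suml mulr_sumr -big_split /=.
  by apply: eq_bigr => i _ /=; rewrite mderivM rmorphD !rmorphM /=; ring.
Qed.

Lemma msize_mderiv n (p : {mpoly R[n]}) i : p != 0 ->
  (msize p^`M(i) < msize p)%N.
Proof.
move=> p0; have [->|q0] := eqVneq p^`M(i) 0.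
  by rewrite msize0 lt0n msize_poly_eq0.
rewrite -mlead_deg //; have := mlead_supp q0; move: (mlead _) => m.
rewrite mcoeff_msupp mcoeff_deriv => h.
have : (m + U_(i))%MM \in msupp p.
  by rewrite mcoeff_msupp; apply: contraNneq h => ->; rewrite mul0rn.
by move=> /msize_mdeg_lt; rewrite mdegD mdeg1 addn1.
Qed.

End Derivations.

Lemma mderiv_eq0_const (K : numFieldType) n (p : {mpoly K[n]}) :
  (forall i, p^`M(i) = 0) -> p = (p@_0)%:MP.
Proof.
move=> h; apply/mpolyP=> m; rewrite mcoeffC.
have [->|m0] := eqVneq m 0%MM; first by rewrite mulr1.
rewrite mulr0; have [i mi] : exists i, m i != 0%N.
  apply/existsP; apply: contraNT m0; rewrite negb_exists => /forallP h0.
  by apply/eqP/mnmP=> i; rewrite mnm0E; apply/eqP; rewrite -[_ == _]negbK.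
have := congr1 (mcoeff (m - U_(i))%MM) (h i).
rewrite mcoeff_deriv mcoeff0 submK ?lep1mP // => /eqP.
by rewrite mulrn_eq0 /= => /eqP.
Qed.

Section DirDeriv.
Variables (K : numClosedFieldType) (N : nat).
Implicit Types (P Q : {mpoly K[N]}) (w : 'cV[K]_N).

Lemma dirderivM w P Q :
  dirderiv w (P * Q) = dirderiv w P * Q + P * dirderiv w Q.
Proof.
rewrite /dirderiv mulr_suml mulr_sumr -big_split; apply: eq_bigr => i _ /=.
by rewrite mderivM scalerDr scalerAl scalerAr.
Qed.

Lemma dirderiv_comp w n (p : {mpoly K[n]}) (t : n.-tuple {mpoly K[N]}) :
  dirderiv w (p \mPo t) =
  \sum_(i < n) (p^`M(i) \mPo t) * dirderiv w (tnth t i).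
Proof.
rewrite /dirderiv; under eq_bigr do rewrite mderiv_comp scaler_sumr.
rewrite exchange_big; apply: eq_bigr => i _ /=.
by rewrite mulr_sumr; apply: eq_bigr => j _; rewrite scalerAr.
Qed.

Lemma comp_mpoly_comp n k (p : {mpoly K[n]}) (t : n.-tuple {mpoly K[k]})
    (s : k.-tuple {mpoly K[N]}) :
  (p \mPo t) \mPo s = p \mPo [tuple tnth t i \mPo s | i < n].
Proof.
elim/mpoly_alg_ind: p => [c|i|p q hp hq|p q hp hq].
- by rewrite !comp_mpolyC.
- by rewrite !comp_mpolyXU -!tnth_nth tnth_mktuple.
- by rewrite !rmorphD /= hp hq.
- by rewrite !rmorphM /= hp hq.
Qed.

(* A relation [Phi(g) = P * S] between the directional derivatives
   [g_i = d_(f_i) P] differentiates to [H a = S g] modulo P, where H is the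
   Hessian and a the gradient of [Phi] at g. If P does not divide [det H],
   this forces a to be proportional to [adj H g]; a relation not involving
   the j-th variable then kills the j-th entry of [adj H g]. *)
Lemma hess_det_divisible n (f : n.+1.-tuple 'cV[K]_N) P :
  irreducible_elt P ->
  (forall j : 'I_n.+1, exists2 G : {mpoly K[n]}, G != 0 &
    divides P (G \mPo [tuple dirderiv (tnth f (lift j i)) P | i < n])) ->
  divides P (hess_det f P).
Proof.
move=> iP hG; have pP := irreducible_mpoly_prime iP.
have [P0 uP _] := iP.
pose g := [tuple dirderiv (tnth f i) P | i < n.+1].
pose H := \matrix_(i < n.+1, j < n.+1)
  dirderiv (tnth f i) (dirderiv (tnth f j) P).
pose h := \adj H *m \col_i tnth g i.
apply: contrapT => nd.
have rel j : exists (a : 'cV_n.+1) S, [/\ a j 0 = 0, exists i, ~ divides P (a i 0),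
    ~ divides P S &
    forall i, divides P (\det H * a i 0 - S * h i 0)].
  (* Among the relations not involving the j-th variable, one of least size is kept. Its partial
     derivatives avoid that variable too and are smaller, so the nonzero ones do not become
     divisible by P at g. *)
  pose good (s : nat) := `[< exists Phi : {mpoly K[n.+1]},
    [/\ Phi != 0, Phi^`M(j) = 0, msize Phi = s & divides P (Phi \mPo g)] >].
  have [|s /asboolP [Phi [Phi0 dPhi sPhi [S eS]]] ms] := @ex_minnP good.
    have [G G0 hGj] := hG j.
    pose t := [tuple ('X_(lift j i) : {mpoly K[n.+1]}) | i < n].
    exists (msize (G \mPo t)); apply/asboolP; exists (G \mPo t); split=> //.
    - have [x Gx] : exists x, G.@[x] != 0.
        apply: contrapT => /forallNP hx; case/eqP: G0.
        by apply: mpoly_eq0_meval => x; apply/eqP/negPn/negP/hx.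
      pose y (u : 'I_n.+1) := if unlift j u is Some l then x l else 0.
      apply: contraNneq Gx => e.
      suff -> : G.@[x] = (G \mPo t).@[y] by rewrite e meval0.
      rewrite comp_mpoly_meval; apply: meval_eq => i.
      by rewrite tnth_mktuple mevalXU /y liftK.
    - rewrite mderiv_comp big1 // => i _; rewrite tnth_mktuple mderivX mnm1E.
      by rewrite eq_sym (negPf (neq_lift _ _)) scale0r mulr0.
    - rewrite comp_mpoly_comp; congr (divides _ (_ \mPo _)): hGj.
      by apply: eq_from_tnth => i;
        rewrite !tnth_mktuple comp_mpolyXU -tnth_nth tnth_mktuple.
  pose a : 'cV_n.+1 := \col_i (Phi^`M(i) \mPo g).
  have ai : exists i, ~ divides P (a i 0).
    have [i di] : exists i, Phi^`M(i) != 0.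
      apply: contrapT => /forallNP hd.
      have e : Phi = (Phi@_0)%:MP.
        by apply: mderiv_eq0_const => i; apply/eqP/negPn/negP/hd.
      have c0 : Phi@_0 != 0 by apply: contraNneq Phi0 => c0; rewrite e c0.
      case/negP: uP; apply/unitrP; exists ((Phi@_0)^-1%:MP * S).
      have: (Phi@_0)^-1%:MP * S * P = 1.
        by rewrite -mulrA -eS e comp_mpolyC -mpolyCM mcoeffC eqxx mulr1 mulVf.
      by rewrite [P * _]mulrC => ->.
    exists i => hi; have /ms : good (msize Phi^`M(i)).
      apply/asboolP; exists Phi^`M(i); split=> //.
        by rewrite mderiv_comm dPhi mderiv0.
      by move: hi; rewrite /a mxE.
    by rewrite -sPhi leqNgt msize_mderiv.
  (* Differentiating [Phi(g) = S * P] along f_i gives (H a)_i = (d_i S) P + S g_i, because the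
     derivative of P along f_i is g_i itself. *)
  have Ha i : divides P ((H *m a) i 0 - S * tnth g i).
    have := dirderiv_comp (tnth f i) Phi g; rewrite eS dirderivM => e.
    exists (dirderiv (tnth f i) S); rewrite mxE.
    have -> : \sum_l H i l * a l 0 =
        \sum_l (Phi^`M(l) \mPo g) * dirderiv (tnth f i) (tnth g l).
      by apply: eq_bigr => l _; rewrite !mxE tnth_mktuple mulrC.
    by rewrite -e tnth_mktuple addrK.
  have Da i : divides P (\det H * a i 0 - S * h i 0).
    have -> : \det H * a i 0 - S * h i 0 =
        \sum_l \adj H i l * ((H *m a) l 0 - S * tnth g l).
      have -> : \det H * a i 0 = (\adj H *m (H *m a)) i 0.
        by rewrite mulmxA mul_adj_mx mul_scalar_mx [RHS]mxE.
      rewrite [(_ *m _) i 0]mxE /h [(_ *m _) i 0]mxE mulr_sumr -sumrB.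
      by apply: eq_bigr => l _; rewrite [(\col_ _ _) l 0]mxE; ring.
    by apply: divides_sum => l _; apply: divides_mull.
  exists a, S; split=> //; first by rewrite mxE dPhi comp_mpoly0.
  (* If P divided S, it would divide det H times every entry of a, hence every entry of a. *)
  move=> [S' eS']; case: ai => i; apply.
  have : divides P (\det H * a i 0).
    rewrite -[_ * _](subrK (S * h i 0)).
    case: (Da i) => u ->; exists (u + S' * h i 0).
    by rewrite eS'; ring.
  by case/pP.
have hh i : divides P (h i 0).
  have [a [S [a0 _ nS /(_ i)]]] := rel i.
  rewrite a0 mulr0 sub0r => -[u e].
  have /pP : divides P (S * h i 0) by exists (- u); rewrite mulNr -e opprK.
  by case.
(* All entries of h are now divisible by P, so any one relation makes P divide det H times an entry
   of a that P does not divide: a contradiction. *)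
have [a [S [_ [i ni] _ /(_ i) [u e]]]] := rel ord0.
have [t et] := hh i.
have /pP : divides P (\det H * a i 0).
  by exists (u + S * t); rewrite mulrDl -e et; ring.
by case.
Qed.

End DirDeriv.

(** * Dual varieties *)

Section Homogeneous.
Variables (R : comNzRingType) (n : nat).
Implicit Types (p : {mpoly R[n]}) (x : 'I_n -> R).

Lemma dhomog_mevalZ d p c x : p \is d.-homog ->
  p.@[fun i => c * x i] = c ^+ d * p.@[x].
Proof.
move=> /dhomogP hp; rewrite !mevalE mulr_sumr !big_seq.
apply: eq_bigr => m /hp <-; under eq_bigr do rewrite exprMn.
rewrite big_split /= mdegE mulrCA; congr (_ * (_ * _)).
by rewrite -expr_sum.
Qed.

Lemma dhomog_meval0 d p x : p \is d.-homog -> (0 < d)%N ->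
  (forall i, x i = 0) -> p.@[x] = 0.
Proof.
move=> hp d0 x0; have -> : p.@[x] = p.@[fun i => 0 * x i].
  by apply: meval_eq => i; rewrite x0 mulr0.
by rewrite (dhomog_mevalZ _ _ hp) expr0n eqn0Ngt d0 mul0r.
Qed.

Lemma dhomog_mderiv d p i : p \is d.-homog -> p^`M(i) \is (d.-1).-homog.
Proof.
move=> hp; apply/dhomogP => m; rewrite mcoeff_msupp mcoeff_deriv => h.
have : (m + U_(i))%MM \in msupp p.
  by rewrite mcoeff_msupp; apply: contraNneq h => ->; rewrite mul0rn.
by move/(dhomogP _ _ _ hp); rewrite /= mdegD mdeg1 addn1 => <-.
Qed.

Lemma dhomog_comp l d p (t : n.-tuple {mpoly R[l]}) : p \is d.-homog ->
  (forall i, tnth t i \is 1.-homog) -> p \mPo t \is d.-homog.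
Proof.
move=> /dhomogP hp ht; rewrite comp_mpolyE big_seq.
apply: rpred_sum => m /hp /= dm; apply: rpredZ.
have -> : d = (\sum_(i < n) 1 * m i)%N.
  by rewrite -dm mdegE; apply: eq_bigr => i _; rewrite mul1n.
elim/big_ind2: _ => [|p1 d1 p2 d2 h1 h2|i _]; first exact: dhomog1.
  exact: dhomogM.
exact: dhomogMn.
Qed.

End Homogeneous.

(** Turns a relation between ratios into one between numerators and denominator. Every monomial of G
    carries a positive power of the last variable, so G vanishes also where the denominator does. *)
Lemma homogenize (K : numFieldType) k (F : {mpoly K[k]}) : F != 0 ->
  exists2 G : {mpoly K[k.+1]}, G != 0 & forall y : 'I_k.+1 -> K,
    (y ord_max != 0 ->
       F.@[fun i => y (widen_ord (leqnSn k) i) / y ord_max] = 0) ->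
    G.@[y] = 0.
Proof.
move=> F0; set D := msize F.
pose G := \sum_(m <- msupp F)
  F@_m *: ('X_[mnmwiden m] * 'X_ord_max ^+ (D - mdeg m).+1) : {mpoly K[k.+1]}.
have GE y : y ord_max != 0 -> G.@[y] = y ord_max ^+ D.+1 *
    F.@[fun i => y (widen_ord (leqnSn k) i) / y ord_max].
  move=> y0; rewrite [F.@[_]]mevalE /G raddf_sum mulr_sumr !big_seq.
  apply: eq_bigr => m hm /=; rewrite mevalZ mevalM rmorphXn /= mevalXU mevalX.
  rewrite big_ord_recr /= mnmwiden_ordmax expr0 mulr1 [RHS]mulrCA; congr (_ * _).
  under [in RHS]eq_bigr do rewrite expr_div_n.
  rewrite big_split /= prodfV -expr_sum -mdegE [RHS]mulrCA; congr (_ * _).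
    by apply: eq_bigr => i _; rewrite mnmwiden_widen.
  have -> : D.+1 = ((D - mdeg m).+1 + mdeg m)%N.
    by rewrite addSn subnK // ltnW // msize_mdeg_lt.
  by rewrite exprD mulfK // expf_neq0.
exists G.
  have [x Fx] : exists x, F.@[x] != 0.
    apply: contrapT => /forallNP hx; case/eqP: F0.
    by apply: mpoly_eq0_meval => x; apply/eqP/negPn/negP/hx.
  have [y [y1 yx]] := meval_extend x 1.
  apply: contraNneq Fx => G0; have := GE y; rewrite G0 meval0 y1 expr1n mul1r.
  rewrite oner_eq0 => /(_ isT) ->; apply/eqP; apply: meval_eq => i.
  by rewrite divr1 -yx.
move=> y hy; have [y0|y0] := eqVneq (y ord_max) 0; last by rewrite GE ?hy ?mulr0.
rewrite /G raddf_sum big1 // => m _ /=.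
by rewrite mevalZ mevalM rmorphXn /= mevalXU y0 expr0n mulr0 mulr0.
Qed.

Section ProjClosure.
Variables (K : closedFieldType) (V : lmodType K).
Implicit Types X : set V.

Lemma sub_proj_closure X : (forall v, X v -> v != 0) -> X `<=` proj_closure X.
Proof. by move=> hX v Xv; split; [exact: hX | move=> m phi _; apply]. Qed.

Lemma proj_closure_closed X : (forall v, X v -> v != 0) ->
  proj_closed (proj_closure X).
Proof.
move=> hX; apply/seteqP; split=> v [v0 hv]; split=> // m phi hphi h.
  by apply: (hv m) => // w [_ hw]; apply: (hw m).
by apply: (hv m) => // w /(sub_proj_closure hX) /h.
Qed.

Lemma polyfunZ m (f : V -> K) c v : homog_polyfun m f ->
  f (c *: v) = c ^+ m * f v.
Proof.
case=> [n [l [p [hp hf]]]]; rewrite !hf -(dhomog_mevalZ _ _ hp).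
by apply: meval_eq => i; rewrite linearZ.
Qed.

End ProjClosure.

Lemma mul_col_polyfun (K : closedFieldType) N (w : 'cV[K]_N) :
  homog_polyfun 1 (fun h : 'rV[K]_N => (h *m w) 0 0).
Proof.
pose l (h : 'rV[K]_N) : K^o := (h *m w) 0 0.
have ll : linear l.
  by move=> a u v; rewrite /l mulmxDl -scalemxAl !mxE.
pose lM := GRing.isLinear.Build _ _ _ _ l ll.
pose lL : {linear 'rV[K]_N -> K^o} := HB.pack l lM.
exists 1%N, (fun=> lL), 'X_ord0; split; first by rewrite dhomogX /= mdeg1.
by move=> v; rewrite mevalXU.
Qed.


Section DualIrreducible.
Variables (K : numClosedFieldType) (N d : nat) (P : {mpoly K[N]}).
Hypotheses (iP : irreducible_elt P) (hP : P \is d.-homog) (d2 : (1 < d)%N).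
Implicit Types (x : 'cV[K]_N) (h : 'rV[K]_N) (phi : 'rV[K]_N -> K).

Let pP : prime_elt P := irreducible_mpoly_prime iP.

Lemma evalW_null Q : (forall x, evalW P x = 0 -> evalW Q x = 0) -> divides P Q.
Proof.
move=> h; apply: hypersurface_nullstellensatz => // x Px.
have ev p : evalW p (\col_i x i) = p.@[x] by apply: meval_eq => i; rewrite mxE.
by rewrite -ev; apply: h; rewrite ev.
Qed.

Lemma divides_evalW Q x : divides P Q -> evalW P x = 0 -> evalW Q x = 0.
Proof. by case=> S ->; rewrite /evalW mevalM => ->; rewrite mulr0. Qed.

Lemma gradient_dirderiv w x : (gradient P x *m w) 0 0 = evalW (dirderiv w P) x.
Proof.
rewrite mxE /evalW /dirderiv raddf_sum; apply: eq_bigr => i _ /=.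
by rewrite mxE mevalZ mulrC.
Qed.

Lemma gradient0 : gradient P 0 = 0.
Proof.
apply/rowP=> i; rewrite !mxE /evalW.
apply: (dhomog_meval0 (dhomog_mderiv i hP)); first by case: d d2 => [|[]].
by move=> j; rewrite mxE.
Qed.

(** A nonzero partial derivative has smaller degree than P, so it is no multiple of P; and in
    characteristic 0 the derivatives of a nonconstant P are not all zero. *)
Lemma exists_ndiv_mderiv : exists i, ~ divides P P^`M(i).
Proof.
have [P0 uP _] := iP.
apply: contrapT => /forallNP h; case/negP: uP.
have e : P = (P@_0)%:MP.
  apply: mderiv_eq0_const => i; apply/eqP; apply: contraT => Pi0.
  have /contrapT [z e] := h i; have := msize_mderiv i P0.
  have z0 : z != 0 by apply: contraNneq Pi0; rewrite e => ->; rewrite mul0r.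
  rewrite e msizeM // (mpolySpred _ z0) addSn /= -ltn_subRL.
  by rewrite ltnNge leq_subr.
by rewrite -mpoly_unit_msize // e msizeC; case: (_ != 0).
Qed.

(** Pull-back of a form along the Gauss map of Z(P). *)
Lemma polyfun_gradient m phi : homog_polyfun m phi ->
  exists Psi : {mpoly K[N]}, forall x, phi (gradient P x) = evalW Psi x.
Proof.
case=> [n [l [p [_ hphi]]]].
exists (p \mPo [tuple \sum_(j < N) l i (delta_mx 0 j) *: P^`M(j) | i < n]).
move=> x; rewrite hphi /evalW comp_mpoly_meval; apply: meval_eq => i.
rewrite tnth_mktuple raddf_sum [gradient P x]row_sum_delta linear_sum /=.
by apply: eq_bigr => j _; rewrite linearZ mevalZ mxE /= mulrC.
Qed.

(** Multiplying [Psi] by a partial derivative not divisible by P makes it vanish at the singular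
    points as well; primality of P then removes the extra factor. *)
Lemma divides_gradient (Psi : {mpoly K[N]}) :
  (forall x, evalW P x = 0 -> gradient P x != 0 -> evalW Psi x = 0) ->
  divides P Psi.
Proof.
move=> h; have [i ni] := exists_ndiv_mderiv.
have /pP : divides P (Psi * P^`M(i)).
  apply: evalW_null => x Px; rewrite /evalW mevalM.
  have [g0|/(h x Px)] := eqVneq (gradient P x) 0; last first.
    by rewrite /evalW => ->; rewrite mul0r.
  by have /rowP/(_ i) := g0; rewrite !mxE /evalW => ->; rewrite mulr0.
by case.
Qed.

Lemma tangent_gradient x : evalW P x = 0 -> gradient P x != 0 ->
  tangent_hyperplanes P (gradient P x).
Proof.
move=> Px g0; exists x, 1; split=> //; rewrite ?oner_eq0 ?scale1r //.
by apply: contraNneq g0 => ->; rewrite gradient0.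
Qed.

Lemma tangent_hyperplanes_neq0 h : tangent_hyperplanes P h -> h != 0.
Proof. by case=> x [c [_ _ g0 c0 ->]]; rewrite scaler_eq0 negb_or c0. Qed.

Lemma tangent_vanish m phi (Psi : {mpoly K[N]}) : homog_polyfun m phi ->
  (forall x, phi (gradient P x) = evalW Psi x) -> divides P Psi ->
  forall h, tangent_hyperplanes P h -> phi h = 0.
Proof.
move=> hphi e dP h [x [c [_ Px _ _ ->]]].
by rewrite (polyfunZ _ _ hphi) e (divides_evalW dP Px) mulr0.
Qed.

(** A closed set not containing the dual variety lies in the zeros of a form whose pull-back along
    the Gauss map is not divisible by P. Two such sets cannot cover, since the product of the
    pull-backs would vanish at the smooth points of Z(P) and P is prime. *)
Lemma dual_variety_irreducible : proj_irreducible (dual_variety P).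
Proof.
split; first exact: (proj_closure_closed tangent_hyperplanes_neq0).
  apply: contrapT => hY; have [_ /negP[]] := iP.
  have [|S e] := divides_gradient (Psi := 1).
    move=> x Px g0; case: hY; exists (gradient P x).
    apply: (sub_proj_closure tangent_hyperplanes_neq0).
    exact: tangent_gradient.
  by apply/unitrP; exists S; split; rewrite // mulrC.
move=> Y Z cY cZ hYZ; apply: contrapT => /not_orP [hY hZ].
have sep X : proj_closed X -> ~ (dual_variety P `<=` X) ->
    exists m phi (Psi : {mpoly K[N]}), [/\ homog_polyfun m phi,
      forall x, phi (gradient P x) = evalW Psi x,
      forall v, X v -> phi v = 0 & ~ divides P Psi].
  move=> cX /existsNP [y /not_implyP [[y0 hy] nXy]].
  move: nXy; rewrite -{1}cX => /not_andP [//|].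
  move/existsNP => [m /existsNP [phi /not_implyP [hphi]]].
  case/not_implyP => hX phiy; have [Psi e] := polyfun_gradient hphi.
  exists m, phi, Psi; split=> // dP; apply: phiy; apply: (hy m) => // w.
  exact: tangent_vanish hphi e dP _.
have [m [phi [Psi [hphi e hv nd]]]] := sep _ cY hY.
have [m' [phi' [Psi' [hphi' e' hv' nd']]]] := sep _ cZ hZ.
have /pP [//|//] : divides P (Psi * Psi').
apply: divides_gradient => x Px g0; rewrite /evalW mevalM.
have /(_ x) := e; have /(_ x) := e'; rewrite /evalW => <- <-.
have /hYZ : dual_variety P (gradient P x).
  apply: (sub_proj_closure tangent_hyperplanes_neq0).
  exact: tangent_gradient.
by case=> [/hv|/hv'] ->; rewrite ?mul0r ?mulr0.
Qed.

(** Being irreducible, the dual variety is a component of itself, so the dimension hypothesis bounds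
    its function field. For each omitted direction this is applied to the ratios of the remaining
    k+2 linear forms to the last of them. *)
Lemma hess_det_divisible_dual k n (f : n.-tuple 'cV[K]_N) : n = k.+3 ->
  proj_dim_le (dual_variety P) k -> divides P (hess_det f P).
Proof.
move=> n3; move: f; rewrite n3 => f hdim.
have {}hdim : function_field_trdeg_le (dual_variety P) k.
  apply: hdim; split; [exact: dual_variety_irreducible | by [] |].
  by move=> Z _ h1 h2; apply/seteqP.
have sT := sub_proj_closure tangent_hyperplanes_neq0.
apply: hess_det_divisible => // j.
pose g (i : 'I_k.+2) := tnth f (lift j i).
have ev G x : evalW (G \mPo [tuple dirderiv (g i) P | i < k.+2]) x =
    G.@[fun i => (gradient P x *m g i) 0 0].
  rewrite /evalW comp_mpoly_meval; apply: meval_eq => i.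
  by rewrite tnth_mktuple gradient_dirderiv.
(* If the denominator vanishes on the whole dual variety, the last variable is itself a relation. *)
have [[y Yy By]|hB] := pselect
    (exists2 y, dual_variety P y & (y *m g ord_max) 0 0 != 0); last first.
  exists 'X_ord_max; first by rewrite -msize_poly_eq0 msizeX.
  apply: divides_gradient => x Px g0; rewrite ev mevalXU.
  apply/eqP; apply: contraT => h; case: hB; exists (gradient P x) => //.
  by apply: sT; apply: tangent_gradient.
have [|F F0 hF] := hdim (fun=> 1%N)
    (fun i h => (h *m g (widen_ord (leqnSn _) i)) 0 0)
    (fun _ h => (h *m g ord_max) 0 0).
  by move=> i; split; [exact: mul_col_polyfun .. | exists y].
have [G G0 hG] := homogenize F0; exists G => //.
apply: divides_gradient => x Px g0; rewrite ev; apply: hG => h.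
by apply: hF => //; apply: sT; apply: tangent_gradient.
Qed.

End DualIrreducible.

(** * Euclidean remainders *)

Section EuclideanRemainder.
Variable K : fieldType.
Implicit Types (p q h r : {poly K}).

(** The reversal X^d p(1/X), with formal degree d independent of the actual degree of p, so that it
    is linear in p. *)
Definition revp d p : {poly K} := \poly_(i < d.+1) p`_(d - i).

Lemma coef_revp d p i : (revp d p)`_i = if (i <= d)%N then p`_(d - i) else 0.
Proof. by rewrite coef_poly ltnS. Qed.

Lemma revpD d p q : revp d (p + q) = revp d p + revp d q.
Proof.
by apply/polyP=> i; rewrite coefD !coef_revp; case: ifP; rewrite ?coefD ?addr0.
Qed.

Lemma revpZ d c p : revp d (c *: p) = c *: revp d p.
Proof.
by apply/polyP=> i; rewrite coefZ !coef_revp; case: ifP; rewrite ?coefZ ?mulr0.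
Qed.

Lemma revpM d f p h : (size p <= d.+1)%N -> (size h <= f.+1)%N ->
  revp (d + f) (p * h) = revp d p * revp f h.
Proof.
move=> sp sh; have -> : h = \sum_(i < f.+1) h`_i *: 'X^i.
  rewrite -poly_def; apply/polyP=> i; rewrite coef_poly.
  by case: ltnP => // hi; rewrite nth_default // (leq_trans sh).
have rD : {morph revp f : x y / x + y} by move=> x y; exact: revpD.
have rD' : {morph revp (d + f) : x y / x + y} by move=> x y; exact: revpD.
have r0 m : revp m 0 = 0 by rewrite -[X in revp m X](scale0r 0) revpZ scale0r.
rewrite mulr_sumr (big_morph _ rD' (r0 _)) (big_morph _ rD (r0 _)) mulr_sumr.
apply: eq_bigr => i _; rewrite -scalerAr !revpZ -scalerAr; congr (_ *: _).
have -> : revp f 'X^i = 'X^(f - i).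
  apply/polyP=> j; rewrite coef_revp !coefXn; have hi := ltn_ord i.
  case: (leqP j f) => hj; last by case: eqP => //; lia.
  by have -> : (f - j == i)%N = (j == f - i)%N by apply/eqP/eqP; lia.
have := ltn_ord i; rewrite ltnS => hi.
apply/polyP=> j; rewrite coef_revp !coefMXn coef_revp.
have [h1|h1] := leqP j (d + f); have [h2|h2] := ltnP j (f - i).
- rewrite ifN; last lia.
  by rewrite nth_default // (leq_trans sp) //; lia.
- have [h3|h3] := ltnP (d + f - j) i.
    by rewrite ifN //; lia.
  by rewrite ifT; [congr (p`_ _); lia | lia].
- by [].
- by rewrite ifN //; lia.
Qed.

(** The expression E as a function of the dehomogenized restrictions p of P and q of Q_f to the
    line. *)
Definition Eform d e p q : K :=
  \sum_(d.-1 <= i < e.+1) \sum_(r < (i.+1 - d).+1)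
    \sum_(j : {ffun 'I_r -> 'I_d.+1} |
            [forall s, 0 < j s]%N && (\sum_s j s == i.+1 - d)%N)
      (-1) ^+ r * q`_i * (\prod_s p`_(d - j s)) * p`_d ^+ (e.+1 - d - r).

Definition revp_tail d p : {poly K} := revp d p - (p`_d)%:P.

(* [revp d p * inv_series d n p = p_d ^ n.+1] modulo ['X^n.+1]. *)
Definition inv_series d n p : {poly K} :=
  \sum_(r < n.+1) (- revp_tail d p) ^+ r * (p`_d)%:P ^+ (n - r).

Lemma revp_tailE d p :
  revp_tail d p = \sum_(j < d.+1 | (0 < j)%N) p`_(d - j) *: 'X^j.
Proof.
rewrite /revp_tail /revp poly_def big_ord_recl /= subn0 expr0 alg_polyC.
by rewrite addrC addKr [RHS]big_mkcond big_ord_recl /= add0r.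
Qed.

(** Expanding the r-th power of the tail produces exactly the compositions (j_1, ..., j_r) of m
    occurring in E. *)
Lemma coef_revp_tail_exp d p (r m : nat) :
  (revp_tail d p ^+ r)`_m =
  \sum_(j : {ffun 'I_r -> 'I_d.+1} |
        [forall s, 0 < j s]%N && (\sum_s j s == m)%N) \prod_s p`_(d - j s).
Proof.
rewrite revp_tailE -[X in _ ^+ X]card_ord -prodr_const.
rewrite (eq_bigl xpredT) // (bigA_distr_big (fun j : 'I_d.+1 => 0 < j)%N
  (fun (_ : 'I_r) (j : 'I_d.+1) => p`_(d - j) *: 'X^j)) /=.
rewrite coef_sum [RHS]big_mkcondr /=; apply: eq_big => [j|j _].
  by apply/ffun_onP/forallP.
rewrite scaler_prod coefZ -expr_sum coefXn eq_sym.
by case: eqP; rewrite ?mulr1 ?mulr0.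
Qed.

Lemma revp_tail_dvdX d p : 'X %| revp_tail d p.
Proof.
rewrite -['X]subr0 -polyC0 dvdp_XsubCl /root horner_coef0.
by rewrite coefB coefC eqxx coef_revp subn0 subrr.
Qed.

Lemma coef_revp_tail_exp_eq0 d p (r m : nat) : (m < r)%N -> (revp_tail d p ^+ r)`_m = 0.
Proof.
move=> mr; have /dvdpP [t ->] : 'X^r %| revp_tail d p ^+ r.
  by apply: dvdp_exp2r; apply: revp_tail_dvdX.
by rewrite coefMXn mr.
Qed.

Lemma coef_exprN p (r m : nat) : ((- p) ^+ r)`_m = (-1) ^+ r * (p ^+ r)`_m.
Proof.
have -> : (- p) ^+ r = ((-1) ^+ r)%:P * p ^+ r by rewrite polyC_exp polyCN exprNn.
by rewrite coefCM.
Qed.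

Lemma coef_inv_series d n p m : (m <= n)%N ->
  (inv_series d n p)`_m =
  \sum_(r < m.+1) \sum_(j : {ffun 'I_r -> 'I_d.+1} |
        [forall s, 0 < j s]%N && (\sum_s j s == m)%N)
    (-1) ^+ r * (\prod_s p`_(d - j s)) * p`_d ^+ (n - r).
Proof.
move=> mn; rewrite coef_sum.
pose F (r : nat) := ((- revp_tail d p) ^+ r * (p`_d)%:P ^+ (n - r))`_m.
have FE (r : nat) : F r = \sum_(j : {ffun 'I_r -> 'I_d.+1} |
        [forall s, 0 < j s]%N && (\sum_s j s == m)%N)
    (-1) ^+ r * (\prod_s p`_(d - j s)) * p`_d ^+ (n - r).
  rewrite /F -polyC_exp coefMC coef_exprN.
  by rewrite coef_revp_tail_exp mulr_sumr mulr_suml.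
(* The tail is divisible by X, so its powers beyond the m-th do not reach degree m. *)
rewrite -(big_mkord predT F) (@big_cat_nat _ _ _ m.+1) //= big_mkord.
rewrite [X in _ + X]big_nat_cond [X in _ + X]big1 ?addr0 => [|r /andP [/andP [mr _] _]].
  by apply: eq_bigr => r _; rewrite FE.
rewrite /F -polyC_exp coefMC coef_exprN.
by rewrite coef_revp_tail_exp_eq0 ?mulr0 ?mul0r.
Qed.

Lemma EformE d e p q : (0 < d)%N -> (d <= e.+1)%N ->
  Eform d e p q = (revp e q * inv_series d (e.+1 - d) p)`_(e.+1 - d).
Proof.
move=> d0 de; rewrite coefMr /Eform -{1}[d.-1]add0n big_addn big_mkord.
have -> : (e.+1 - d.-1 = (e.+1 - d).+1)%N by lia.
apply: eq_bigr => m _; have := ltn_ord m; rewrite ltnS => hm.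
rewrite coef_revp ifT ?coef_inv_series //; last by lia.
have -> : (e - (e.+1 - d - m) = m + d.-1)%N by lia.
have -> : ((m + d.-1).+1 - d = m)%N by lia.
rewrite mulr_sumr; apply: eq_bigr => r _; rewrite mulr_sumr.
by apply: eq_bigr => j _; ring.
Qed.

Lemma revp_inv_series d n p : revp d p * inv_series d n p =
  (p`_d ^+ n.+1)%:P - (- revp_tail d p) ^+ n.+1.
Proof.
rewrite polyC_exp subrXX; congr (_ * _).
  by rewrite opprK /revp_tail addrC subrK.
by apply: eq_bigr => i _; rewrite mulrC.
Qed.

Lemma EformD d e p q1 q2 :
  Eform d e p (q1 + q2) = Eform d e p q1 + Eform d e p q2.
Proof.
rewrite /Eform -big_split; apply: eq_bigr => i _; rewrite -big_split.
apply: eq_bigr => r _; rewrite -big_split; apply: eq_bigr => j _ /=.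
by rewrite coefD; ring.
Qed.

Lemma EformZ d e p q c : Eform d e p (c *: q) = c * Eform d e p q.
Proof.
rewrite /Eform mulr_sumr; apply: eq_bigr => i _; rewrite mulr_sumr.
apply: eq_bigr => r _; rewrite mulr_sumr; apply: eq_bigr => j _ /=.
by rewrite coefZ; ring.
Qed.

(** With n = e + 1 - d, the reversed p times the series is a constant modulo X^(n+1), and the
    reversed h has degree at most e - d = n - 1: nothing is left in degree n. *)
Lemma Eform_mul d e p h : (0 < d)%N -> (d <= e)%N -> (size p <= d.+1)%N ->
  (size h <= (e - d).+1)%N -> Eform d e p (p * h) = 0.
Proof.
move=> d0 de sp sh; rewrite EformE ?leqW //.
rewrite -{1}(subnKC de) revpM // mulrAC revp_inv_series mulrBl coefB.
have /dvdpP [t ->] : 'X ^+ (e.+1 - d).+1 %| (- revp_tail d p) ^+ (e.+1 - d).+1.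
  by apply: dvdp_exp2r; rewrite dvdpNr revp_tail_dvdX.
rewrite coefCM mulrAC coefMXn ltnS leqnn subr0 coef_revp ifN ?mulr0 //; lia.
Qed.

(** Together with [Eform_mul] and additivity in q, this identifies E with a power of p_d times the
    coefficient of x^(d-1) in the remainder of q by p. *)
Lemma Eform_small d e p r : (0 < d)%N -> (d <= e.+1)%N -> (size r <= d)%N ->
  Eform d e p r = p`_d ^+ (e.+1 - d) * r`_d.-1.
Proof.
move=> d0 de sr; rewrite EformE // coefM big_ord_recr /= subnn.
rewrite coef_inv_series // big1 ?add0r => [|i _].
  rewrite big_ord1 (big_pred1 [ffun=> ord0]) => [|j].
    rewrite big_ord0 expr0 subn0 mulr1 mul1r mulrC coef_revp ifT; last lia.
    by congr (_ * r`_ _); lia.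
  rewrite big_ord0 eqxx andbT.
  by apply/forallP/eqP => [_|_ [] //]; apply/ffunP=> -[].
rewrite coef_revp; case: ifP => _; last by rewrite mul0r.
rewrite [r`__]nth_default ?mul0r //.
by rewrite (leq_trans sr) //; have := ltn_ord i; lia.
Qed.

(** The degenerate case, where Euclidean division gives no information: the series reduces to the
    top power of the tail, whose lowest term is a power of p_(d-1). It also evaluates E at the
    witness for nonvanishing. *)
Lemma Eform_lead0 d e p q : (0 < d)%N -> (d <= e.+1)%N -> p`_d = 0 ->
  Eform d e p q = q`_e * (- p`_d.-1) ^+ (e.+1 - d).
Proof.
move=> d0 de pd; rewrite EformE //; set n := (e.+1 - d)%N.
have -> : inv_series d n p = (- revp_tail d p) ^+ n.
  rewrite /inv_series big_ord_recr /= subnn expr0 mulr1 big1 ?add0r // => i _.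
  by rewrite pd polyC0 expr0n subn_eq0 leqNgt ltn_ord mulr0.
have [t et] : exists t, revp_tail d p = t * 'X.
  by apply/dvdpP; apply: revp_tail_dvdX.
have t0 : t`_0 = p`_d.-1.
  have := congr1 (fun u : {poly K} => u`_1) et; rewrite coefMX /= => <-.
  by rewrite coefB coefC subr0 coef_revp d0 subn1.
rewrite et -mulNr exprMn mulrA coefMXn ltnn subnn -!horner_coef0.
rewrite hornerM horner_exp hornerN !horner_coef0 t0.
by rewrite coef_revp leq0n subn0.
Qed.

Lemma comp_poly_XaddC_coef m p b : (size p <= m.+1)%N ->
  (p \Po ('X + b%:P))`_m = p`_m.
Proof.
move=> sp; have -> : p = \sum_(i < m.+1) p`_i *: 'X^i.
  rewrite -poly_def; apply/polyP=> i; rewrite coef_poly.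
  by case: ltnP => // hi; rewrite nth_default // (leq_trans sp).
rewrite raddf_sum /= !coef_sum; apply: eq_bigr => i _.
rewrite comp_polyZ comp_Xn_poly !coefZ coefXn; congr (_ * _).
have -> : 'X + b%:P = 'X - (- b)%:P by rewrite polyCN opprK.
have := ltn_ord i; rewrite ltnS leq_eqVlt => /orP [/eqP e|im].
  have /monicP := monic_exp m (monicXsubC (- b)).
  by rewrite /lead_coef size_exp_XsubC e eqxx.
by rewrite nth_default ?size_exp_XsubC // gtn_eqF.
Qed.

(** Euclidean division commutes with translation of the variable, and translation preserves the
    coefficient in the top formal degree. When p_d = 0 the closed form of [Eform_lead0] shows the
    invariance directly. *)
Lemma Eform_shift d e p q b : (0 < d)%N -> (d <= e)%N -> (size p <= d.+1)%N ->
  (size q <= e.+1)%N ->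
  Eform d e (p \Po ('X + b%:P)) (q \Po ('X + b%:P)) = Eform d e p q.
Proof.
move=> d0 de sp sq; have [pd|pd] := eqVneq p`_d 0.
  have sp' : (size p <= d.-1.+1)%N.
    rewrite prednK //; move: sp; rewrite leq_eqVlt => /orP [/eqP h|//].
    have : lead_coef p == 0 by rewrite /lead_coef h pd.
    by rewrite lead_coef_eq0 => /eqP p0; move: h; rewrite p0 size_poly0.
  rewrite !Eform_lead0 ?leqW // ?comp_poly_XaddC_coef //.
have spE : size p = d.+1.
  apply/eqP; rewrite eqn_leq sp ltnNge; apply: contra pd => h.
  by rewrite nth_default.
have p0 : p != 0 by rewrite -size_poly_eq0 spE.
have := divp_eq q p; set h := q %/ p; set r := q %% p => eq.
have sh : (size h <= (e - d).+1)%N.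
  by rewrite /h size_divp // spE /= leq_subLR addnS subnKC.
have sr : (size r <= d)%N by rewrite -ltnS -spE ltn_modp.
have sz s : size (s \Po ('X + b%:P)) = size s.
  by rewrite size_comp_poly2 ?size_XaddC.
rewrite eq [h * p]mulrC raddfD /= rmorphM /= !EformD.
rewrite !Eform_mul ?sz // !add0r !Eform_small ?leqW ?sz //.
by rewrite !comp_poly_XaddC_coef // prednK.
Qed.

(** Every term of E is homogeneous. With n = e + 1 - d, its weight in a is i + (r d - (i + 1 - d)) +
    d (n - r) = d - 1 + d n, and in b it is (e - i) + (i + 1 - d) = n. *)
Lemma Eform_scale d e p q a b : (0 < d)%N -> (d <= e.+1)%N ->
  Eform d e (\poly_(j < d.+1) (a ^+ j * b ^+ (d - j) * p`_j))
            (\poly_(i < e.+1) (a ^+ i * b ^+ (e - i) * q`_i)) =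
  a ^+ (d.-1 + d * (e.+1 - d)) * b ^+ (e.+1 - d) * Eform d e p q.
Proof.
move=> d0 de; rewrite /Eform !big_nat mulr_sumr; apply: eq_bigr => i /andP [i1 i2].
rewrite mulr_sumr; apply: eq_bigr => r _; rewrite mulr_sumr.
apply: eq_bigr => j /andP [_ /eqP sj]; rewrite !coef_poly i2 ltnSn.
have ps (s : 'I_r) :
    (\poly_(j < d.+1) (a ^+ j * b ^+ (d - j) * p`_j))`_(d - j s) =
    a ^+ (d - j s) * b ^+ (j s) * p`_(d - j s).
  by rewrite coef_poly ltnS leq_subr subKn // -ltnS.
rewrite (eq_bigr _ (fun s _ => ps s)).
rewrite !big_split /= -!expr_sum sj subnn mulr1 !exprMn -exprM.
have rm : (r <= i.+1 - d)%N by rewrite -ltnS.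
set S := (\sum_(s < r) _)%N.
have eS : (S + (i.+1 - d) = r * d)%N.
  transitivity (\sum_(s < r) (d - j s + j s))%N; first by rewrite big_split sj.
  rewrite (eq_bigr (fun=> d)) => [|s _]; last by rewrite subnK // -ltnS.
  by rewrite sum_nat_const card_ord.
have -> : (d.-1 + d * (e.+1 - d) = i + S + d * (e.+1 - d - r))%N.
  have rn : (r * d <= d * (e.+1 - d))%N by rewrite mulnC leq_mul2l; lia.
  rewrite [in RHS]mulnBr [(d * r)%N]mulnC; move: rn eS.
  by move: (d * (e.+1 - d))%N (r * d)%N => A B; lia.
have -> : b ^+ (e.+1 - d) = b ^+ (e - i) * b ^+ (i.+1 - d).
  by rewrite -exprD; congr (_ ^+ _); lia.
by rewrite !exprD; ring.
Qed.

End EuclideanRemainder.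

(** * Restriction to lines *)

Lemma mderiv_lin_form (R : comNzRingType) n (c : 'I_n -> R) j :
  (\sum_l c l *: 'X_l : {mpoly R[n]})^`M(j) = (c j)%:MP.
Proof.
rewrite raddf_sum (bigD1 j) //= big1 => [|l lj].
  rewrite mderivZ mderivX mnm1E eqxx scale1r addr0.
  by rewrite submm mpolyX0 -alg_mpolyC.
by rewrite mderivZ mderivX mnm1E (negPf lj) scale0r scaler0.
Qed.

Section LineRestriction.
Variables (K : numClosedFieldType) (N : nat).
Implicit Types (P Q : {mpoly K[N]}) (u v w : 'cV[K]_N) (g : 'M[K]_N).

(** P(xu + v): the restriction to the line dehomogenized at y = 1, where univariate division is
    available. *)
Definition line_poly u v : {mpoly K[N]} -> {poly K} :=
  mmap (@polyC K) (fun i => (u i 0)%:P * 'X + (v i 0)%:P).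

HB.instance Definition _ u v := GRing.RMorphism.on (line_poly u v).

Lemma line_polyX u v i : line_poly u v 'X_i = (u i 0)%:P * 'X + (v i 0)%:P.
Proof. by rewrite /line_poly mmapX mmap1U. Qed.

Lemma line_polyC u v c : line_poly u v c%:MP = c%:P.
Proof. by rewrite /line_poly mmapC. Qed.

Lemma line_polyZ u v c P : line_poly u v (c *: P) = c *: line_poly u v P.
Proof. by rewrite /line_poly mmapZ mul_polyC. Qed.

Lemma size_line_poly d u v P : P \is d.-homog ->
  (size (line_poly u v P) <= d.+1)%N.
Proof.
move=> /dhomogP hP; rewrite /line_poly /mmap big_seq.
apply: (leq_trans (size_sum _ _ _)); apply/bigmax_leqP_seq => m hm _.
rewrite mul_polyC; apply: (leq_trans (size_scale_leq _ _)).
have <- := hP m hm; rewrite /= mdegE /mmap1.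
elim/big_rec2: _ => [|i k p _ IH]; first by rewrite size_poly1.
apply: (leq_trans (size_polyMleq _ _)).
have := size_poly_exp_leq ((u i 0)%:P * 'X + (v i 0)%:P) (m i).
have : (size ((u i 0)%:P * 'X + (v i 0)%:P)%R <= 2)%N.
  rewrite size_MXaddC; case: ifP => // _; rewrite ltnS.
  by rewrite size_polyC; case: (_ == 0).
set L := _ * 'X + _ => sL.
have {sL} : ((size L).-1 * m i <= m i)%N.
  by rewrite -[leqRHS]mul1n leq_mul2r; case: (size L) sL => [|[|[|]]] //=;
     rewrite ?orbT.
move: IH; move: (size (L ^+ _)) (size k) ((size L).-1 * m i)%N => a b c; lia.
Qed.

Lemma dehomogenize_coef d (L : {mpoly K[2]}) a : L \is d.-homog -> (a <= d)%N ->
  (mmap (@polyC K) (fun i : 'I_2 => if i == 0 then 'X else 1) L)`_a =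
  L@_(U_(0%R : 'I_2) *+ a + U_(1%R : 'I_2) *+ (d - a))%MM.
Proof.
move=> /dhomogP hL ad; rewrite /mmap coef_sum.
set m0 := (_ + _)%MM; have m00 : m0 0 = a.
  by rewrite mnmDE !mulmnE !mnm1E /= mul1n mul0n addn0.
have m01 : m0 1 = (d - a)%N.
  by rewrite mnmDE !mulmnE !mnm1E /= mul1n mul0n.
have cE m : m \in msupp L -> ((L@_m)%:P *
    mmap1 (fun i : 'I_2 => if i == 0 then 'X else 1) m)`_a =
    L@_m * (m == m0)%:R.
  move=> hm; rewrite coefCM /mmap1 !big_ord_recl big_ord0 /= mulr1 expr1n mulr1.
  rewrite coefXn; congr (_ * _%:R); congr nat_of_bool; apply/eqP/eqP => [e|->//].
  apply/mnmP => i; case: (unliftP 0 i) => [j|] ->; last by rewrite m00.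
  rewrite (ord1 j) (_ : lift _ _ = 1) ?m01; last exact: val_inj.
  have := hL m hm; rewrite /= mdegE !big_ord_recl big_ord0 /= addn0 -e.
  by rewrite (_ : lift ord0 ord0 = 1); [lia | exact: val_inj].
rewrite big_seq (eq_bigr _ (fun m hm => cE m hm)) -big_seq.
have [h|h] := boolP (m0 \in msupp L); last first.
  rewrite (memN_msupp_eq0 h) big_seq big1 // => m hm.
  by case: eqP hm h => [-> ->|_ _ _] //; rewrite mulr0.
rewrite (bigD1_seq m0) ?msupp_uniq //= eqxx mulr1 big1 ?addr0 // => m.
by move=> /negPf ->; rewrite mulr0.
Qed.

Lemma line_restr_homog d u v P : P \is d.-homog ->
  line_restr u v P \is d.-homog.
Proof.
move=> hP; apply: dhomog_comp => // i; rewrite tnth_mktuple.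
by apply: rpredD; apply: rpredZ; rewrite dhomogX /= mdeg1.
Qed.

Lemma line_coefE d u v P a : P \is d.-homog -> (a <= d)%N ->
  line_coef u v P a (d - a) = (line_poly u v P)`_a.
Proof.
move=> hP ad; rewrite /line_coef -(dehomogenize_coef (line_restr_homog u v hP) ad).
suff -> : line_poly u v P = mmap (@polyC K)
    (fun i : 'I_2 => if i == 0 then 'X else 1) (line_restr u v P) by [].
rewrite /line_restr; elim/mpoly_alg_ind: P {hP} => [c|i|p q hp hq|p q hp hq].
- by rewrite comp_mpolyC mmapC line_polyC.
- rewrite comp_mpolyXU -tnth_nth tnth_mktuple line_polyX mmapD !mmapZ.
  by rewrite !mmapX !mmap1U /= mulr1.
- by rewrite !rmorphD /= hp hq.
- by rewrite !rmorphM /= hp hq.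
Qed.

Lemma mcoeff_comp_scale n (c : 'I_n -> K) (p : {mpoly K[n]}) m :
  (p \mPo [tuple c i *: 'X_i | i < n])@_m = (\prod_i c i ^+ m i) * p@_m.
Proof.
elim/mpolyind: p => [|a l p _ _ IH].
  by rewrite comp_mpoly0 mcoeff0 mulr0.
rewrite comp_mpolyD comp_mpolyZ !mcoeffD IH mulrDr !mcoeffZ; congr (_ + _).
rewrite comp_mpolyX mcoeffX.
under [in LHS]eq_bigr do rewrite tnth_mktuple exprZn.
rewrite scaler_prod -mpolyXE_id mcoeffZ mcoeffX.
by case: eqP => [->|_]; rewrite ?mulr0 // !mulr1 mulrC.
Qed.

Lemma line_poly_scale d u v P a b : P \is d.-homog ->
  line_poly (a *: u) (b *: v) P =
  \poly_(j < d.+1) (a ^+ j * b ^+ (d - j) * (line_poly u v P)`_j).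
Proof.
move=> hP; apply/polyP=> j; rewrite coef_poly.
case: ltnP => hj; last by rewrite nth_default // (leq_trans (size_line_poly _ _ hP)).
rewrite -!(line_coefE _ _ hP) // /line_coef.
pose c (i : 'I_2) := if i == 0 then a else b.
have -> : line_restr (a *: u) (b *: v) P =
    line_restr u v P \mPo [tuple c i *: 'X_i | i < 2].
  rewrite /line_restr comp_mpoly_comp; congr (_ \mPo _).
  apply: eq_from_tnth => i; rewrite !tnth_mktuple rmorphD /= !comp_mpolyZ.
  by rewrite !comp_mpolyXU -!tnth_nth !tnth_mktuple /c /= !mxE !scalerA
     mulrC [b * _]mulrC.
rewrite mcoeff_comp_scale; congr (_ * _).
rewrite !big_ord_recl big_ord0 mulr1 /c /= !mnmDE !mulmnE !mnm1E /=.
by rewrite !mul1n !mul0n addn0.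
Qed.

Lemma line_poly_shift u v P b :
  line_poly u (v + b *: u) P = line_poly u v P \Po ('X + b%:P).
Proof.
elim/mpoly_alg_ind: P => [c|i|p q hp hq|p q hp hq].
- by rewrite !line_polyC comp_polyC.
- rewrite !line_polyX !mxE comp_polyD comp_polyM !comp_polyC comp_polyX.
  by rewrite polyCD polyCM; ring.
- by rewrite !rmorphD /= hp hq.
- by rewrite !rmorphM /= hp hq.
Qed.

Lemma line_poly_subst u v P g :
  line_poly u v (P \mPo lin_subst g) = line_poly (g *m u) (g *m v) P.
Proof.
elim/mpoly_alg_ind: P => [c|i|p q hp hq|p q hp hq].
- by rewrite comp_mpolyC !line_polyC.
- rewrite comp_mpolyXU -tnth_nth tnth_mktuple line_polyX raddf_sum.
  rewrite !mxE !rmorph_sum mulr_suml -big_split; apply: eq_bigr => j _ /=.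
  by rewrite line_polyZ line_polyX -mul_polyC !polyCM; ring.
- by rewrite !rmorphD /= hp hq.
- by rewrite !rmorphM /= hp hq.
Qed.

Lemma dirderiv_subst w P g :
  dirderiv w (P \mPo lin_subst g) = dirderiv (g *m w) P \mPo lin_subst g.
Proof.
rewrite dirderiv_comp /dirderiv raddf_sum; apply: eq_bigr => i _ /=.
rewrite tnth_mktuple comp_mpolyZ mxE scaler_suml mulr_sumr.
apply: eq_bigr => j _; rewrite mderiv_lin_form.
by rewrite -scalerAr mulrC mul_mpolyC scalerA mulrC.
Qed.

Lemma dirderiv_sum w P n (c : 'I_n -> K) (e : 'I_n -> 'cV[K]_N) :
  w = \sum_j c j *: e j -> dirderiv w P = \sum_j c j *: dirderiv (e j) P.
Proof.
move=> ->; rewrite /dirderiv; under [RHS]eq_bigr do rewrite scaler_sumr.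
rewrite exchange_big; apply: eq_bigr => i _ /=.
rewrite summxE scaler_suml; apply: eq_bigr => j _.
by rewrite mxE scalerA.
Qed.

Lemma dirderiv_is_linear w : linear (dirderiv w).
Proof.
move=> a P Q; rewrite /dirderiv scaler_sumr -big_split; apply: eq_bigr => i _ /=.
by rewrite mderivD mderivZ scalerDr !scalerA mulrC.
Qed.

HB.instance Definition _ w :=
  GRing.isLinear.Build K {mpoly K[N]} {mpoly K[N]} _ (dirderiv w)
    (dirderiv_is_linear w).

Lemma dirderiv_homog d w P : P \is d.-homog -> dirderiv w P \is (d.-1).-homog.
Proof.
move=> hP; apply: rpred_sum => i _; apply: rpredZ; exact: dhomog_mderiv.
Qed.

Lemma det_homog n c (A : 'M[{mpoly K[N]}]_n) :
  (forall i j, A i j \is c.-homog) -> \det A \is (n * c).-homog.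
Proof.
move=> hA; apply: rpred_sum => s _.
rewrite mulr_sign; suff h : \prod_i A i (s i) \is (n * c).-homog.
  by case: ifP => _; rewrite ?rpredN.
have -> : (n * c = \sum_(i < n) c)%N by rewrite sum_nat_const card_ord.
elim/big_ind2: _ => [|p a q b hp hq|i _]; [exact: dhomog1 | | exact: hA].
exact: dhomogM.
Qed.

Lemma hess_det_homog n d (f : n.-tuple 'cV[K]_N) P : P \is d.-homog ->
  hess_det f P \is (n * (d - 2)).-homog.
Proof.
move=> hP; apply: det_homog => i j; rewrite mxE subn2.
by do 2! apply: dirderiv_homog.
Qed.

Lemma hess_det_subst n (f : n.-tuple 'cV[K]_N) P g :
  hess_det f (P \mPo lin_subst g) =
  hess_det [tuple g *m tnth f i | i < n] P \mPo lin_subst g.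
Proof.
rewrite /hess_det -det_map_mx; congr (\det _); apply/matrixP=> i j.
by rewrite !mxE !tnth_mktuple !dirderiv_subst.
Qed.

(** The Hessian is a bilinear form on F, hence changes by congruence. The square obtained here is
    the coefficient 2 of the last fundamental weight in [Omega]. *)
Lemma hess_det_change n (f e : n.-tuple 'cV[K]_N) (C : 'M[K]_n) P :
  (forall j, tnth f j = \sum_i C i j *: tnth e i) ->
  hess_det f P = (\det C ^+ 2) *: hess_det e P.
Proof.
move=> fe; rewrite /hess_det; set H := \matrix_(i, j) _; set H' := \matrix_(i, j) _.
have -> : H = (map_mx (@mpolyC N K) C)^T *m H' *m map_mx (@mpolyC N K) C.
  apply/matrixP=> i j; rewrite mxE (dirderiv_sum _ (fe i)) mxE.
  under [RHS]eq_bigr do rewrite mxE mulr_suml.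
  rewrite exchange_big; apply: eq_bigr => l _ /=.
  rewrite (dirderiv_sum _ (fe j)) [dirderiv _ (\sum_(_ < n) _)]linear_sum.
  rewrite scaler_sumr; apply: eq_bigr => t _.
  by rewrite linearZ !mxE /= -!mul_mpolyC; ring.
rewrite !det_mulmx det_tr det_map_mx -mul_mpolyC expr2 mpolyCM /=; ring.
Qed.
End LineRestriction.

(** * The equations *)

Lemma horner_line_poly (K : numClosedFieldType) N (P : {mpoly K[N]}) u v c :
  (line_poly u v P).[c] = evalW P (c *: u + v).
Proof.
rewrite /evalW; elim/mpoly_alg_ind: P => [a|i|p q hp hq|p q hp hq].
- by rewrite line_polyC hornerC mevalC.
- by rewrite line_polyX !hornerE mevalXU !mxE mulrC.
- by rewrite rmorphD hornerD hp hq mevalD.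
- by rewrite rmorphM hornerM hp hq mevalM.
Qed.

Lemma line_poly_lead (K : numClosedFieldType) N d (P : {mpoly K[N]}) u v :
  P \is d.-homog -> (line_poly u v P)`_d = evalW P u.
Proof.
move=> hP; have := line_poly_scale u v 1 0 hP.
rewrite scale1r scale0r => /(congr1 (horner^~ 1)).
rewrite horner_line_poly scale1r addr0 => ->.
rewrite horner_poly big_ord_recr /= big1 ?add0r => [|i _].
  by rewrite !expr1n subnn expr0 !mul1r mulr1.
by rewrite expr0n subn_eq0 leqNgt ltn_ord mulr0 !mul0r.
Qed.

Section EfunProperties.
Variables (K : numClosedFieldType) (N k d : nat).
Hypothesis hd : (3 <= d)%N.
Implicit Types (P : dhomog N K d) (u v w : 'cV[K]_N) (g h : 'M[K]_N).
Implicit Types (f : (k + 3).-tuple 'cV[K]_N).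

Local Notation hdeg := ((k + 3) * (d - 2))%N.

Let d_gt0 : (0 < d)%N. Proof. exact: leq_trans hd. Qed.

Let d_le_e : (d <= hdeg)%N.
Proof. by have := leq_mul (leqnn (d - 2)) (leq_addl k 3); lia. Qed.

(** The exponent with which E scales in v, which is the coefficient of the second fundamental
    weight. The exponent in u, treated next, is the sum of the first two coefficients, as both
    weights involve b_11. *)
Lemma weight_exponent2 : (hdeg.+1 - d = d * (k + 2) - 2 * k - 5)%N.
Proof.
have -> : d = (d - 3 + 3)%N by lia.
move: (d - 3)%N => c; have -> : (c + 3 - 2 = c + 1)%N by lia.
by rewrite !mulnDl !mulnDr; move: (k * c)%N (c * k)%N (mulnC k c) => a b; lia.
Qed.

Lemma weight_exponent1 : (d.-1 + d * (hdeg.+1 - d) =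
  (d - 1) * (d - 2) * (k + 2) + (d * (k + 2) - 2 * k - 5))%N.
Proof.
rewrite -weight_exponent2; have -> : d = (d - 3 + 3)%N by lia.
move: (d - 3)%N => c; have -> : (c + 3 - 2 = c + 1)%N by lia.
have -> : (((k + 3) * (c + 1)).+1 - (c + 3) = c * k + 2 * c + k + 1)%N by nia.
have -> : ((c + 3).-1 = c + 2)%N by lia.
have -> : (c + 3 - 1 = c + 2)%N by lia.
nia.
Qed.

Lemma Efun_Eform f u v P :
  Efun f u v P =
  Eform d hdeg (line_poly u v (P : {mpoly K[N]})) (line_poly u v (hess_det f P)).
Proof.
have hP : (P : {mpoly K[N]}) \is d.-homog := dhomog_is_dhomog P.
have hQ := hess_det_homog f hP.
rewrite /Efun /Eform; apply: eq_big_nat => i /andP [_ hi].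
apply: eq_bigr => r _; apply: eq_bigr => j _.
rewrite (line_coefE _ _ hQ) // (line_coefE _ _ hP) //; congr (_ * _ * _).
by apply: eq_bigr => s _; rewrite (line_coefE _ _ hP) // leq_subr.
Qed.

Lemma pihomog_dhomog n (m1 m2 : nat) (p : {mpoly K[n]}) : p \is m2.-homog ->
  pihomog mdeg m1 p = if m2 == m1 then p else 0.
Proof.
move=> hp; case: eqP => [<-|/eqP ne]; first exact: pihomog_dE.
exact: pihomog_ne0 hp.
Qed.

(** Any cofactor may be replaced by its homogeneous component of the right degree. *)
Lemma divides_homog n (m1 m2 : nat) (p q : {mpoly K[n]}) : p \is m1.-homog ->
  q \is m2.-homog -> (m1 <= m2)%N -> divides p q ->
  exists s : {mpoly K[n]}, s \is (m2 - m1).-homog /\ q = p * s.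
Proof.
move=> hp hq le12 [s eq]; exists (pihomog mdeg (m2 - m1) s); split.
  exact: pihomogP.
rewrite -[LHS](pihomog_dE hq) eq.
have lt : (m2 - m1 < msize s + (m2 - m1).+1)%N by rewrite addnS ltnS leq_addl.
have {1}-> : s = \sum_(i < msize s + (m2 - m1).+1) pihomog mdeg i s.
  by apply: pihomog_partitionE; exact: leq_addr.
rewrite mulr_suml raddf_sum /= (bigD1 (Ordinal lt)) //= big1 => [|i ni].
  rewrite addr0 [_ * p]mulrC pihomog_dE //.
  by have := dhomogM hp (pihomogP mdeg (m2 - m1) s); rewrite subnKC.
rewrite [_ * p]mulrC (pihomog_dhomog m2 (dhomogM hp (pihomogP mdeg i s))).
rewrite ifN //; apply: contraNneq ni => eb; apply/eqP/val_inj => /=.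
by have := congr1 (subn^~ m1) eb; rewrite addKn.
Qed.

Lemma Efun_divides f u v P : divides (P : {mpoly K[N]}) (hess_det f P) ->
  Efun f u v P = 0.
Proof.
have hP : (P : {mpoly K[N]}) \is d.-homog := dhomog_is_dhomog P.
move=> /(divides_homog hP (hess_det_homog f hP) d_le_e) [s [hs eq]].
rewrite Efun_Eform eq rmorphM /= Eform_mul //.
  exact: size_line_poly.
exact: size_line_poly.
Qed.

Lemma Efun_dual_vanish f u v P : irreducible_mpoly (P : {mpoly K[N]}) ->
  proj_dim_le (dual_variety (P : {mpoly K[N]})) k -> Efun f u v P = 0.
Proof.
move=> iP hdim; apply: Efun_divides.
apply: (hess_det_divisible_dual iP (dhomog_is_dhomog P) _ f _ hdim).
  exact: leq_trans hd.
by rewrite addn3.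
Qed.

(** E depends on the flag only, up to scale: adding a multiple of u to v is a translation of x,
    scaling u and v is [Eform_scale], and changing the basis of F is a congruence. Nonzero a lets c
    u be expressed through a u. *)
Lemma Efun_flag f f' u v P (a b c : K) (C : 'M[K]_(k + 3)) : a != 0 ->
  (forall j, tnth f j = \sum_i C i j *: tnth f' i) ->
  Efun f (a *: u) (b *: v + c *: u) P =
  \det C ^+ 2 * (a ^+ (d.-1 + d * (hdeg.+1 - d)) * b ^+ (hdeg.+1 - d)) * Efun f' u v P.
Proof.
have hP : (P : {mpoly K[N]}) \is d.-homog := dhomog_is_dhomog P.
have hQ := hess_det_homog f hP.
move=> a0 fe; rewrite !Efun_Eform.
have -> : c *: u = (c / a) *: (a *: u) by rewrite scalerA divfK.
rewrite !line_poly_shift Eform_shift ?size_line_poly //.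
rewrite (line_poly_scale _ _ _ _ hP) (line_poly_scale _ _ _ _ hQ).
rewrite (Eform_scale _ _ _ _ d_gt0 (leqW d_le_e)) (hess_det_change _ fe).
by rewrite line_polyZ EformZ mulrCA mulrA.
Qed.

Lemma pullback_mul g h P : pullback h (pullback g P) = pullback (g *m h) P.
Proof.
apply: val_inj => /=; rewrite comp_mpoly_comp; congr (_ \mPo _).
apply: eq_from_tnth => i; rewrite !tnth_mktuple raddf_sum /=.
under eq_bigr do rewrite comp_mpolyZ comp_mpolyXU -tnth_nth tnth_mktuple scaler_sumr.
rewrite exchange_big; apply: eq_bigr => j _ /=; rewrite mxE scaler_suml.
by apply: eq_bigr => l _; rewrite scalerA.
Qed.

Lemma act_mul g h (phi : dhomog N K d -> K) :
  act (g *m h) phi = act g (act h phi).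
Proof. by apply/funext => P; rewrite /act pullback_mul. Qed.

Lemma act_Efun g f u v : act g (Efun (d := d) f u v) =
  Efun [tuple g *m tnth f i | i < k + 3] (g *m u) (g *m v).
Proof.
apply/funext => P; rewrite /act !Efun_Eform /= hess_det_subst.
by rewrite !line_poly_subst.
Qed.

Hypothesis hN : (k + 3 <= N)%N.

Let lt0 : (0 < k + 3)%N. Proof. by rewrite addnS. Qed.
Let lt1 : (1 < k + 3)%N. Proof. by rewrite !addnS. Qed.

Definition std_index (i : 'I_(k + 3)) : 'I_N := widen_ord hN i.
Definition std_frame : (k + 3).-tuple 'cV[K]_N :=
  [tuple delta_mx (std_index i) 0 | i < k + 3].
Definition std_u := tnth std_frame (Ordinal lt0).
Definition std_v := tnth std_frame (Ordinal lt1).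
Definition Estd : dhomog N K d -> K := Efun std_frame std_u std_v.

Lemma std_uv_frame : exists i j : 'I_(k + 3),
  [/\ i != j, std_u = tnth std_frame i & std_v = tnth std_frame j].
Proof. by exists (Ordinal lt0), (Ordinal lt1). Qed.

Lemma fund_weightE m g (hm : (m <= N)%N) :
  fund_weight m g = \prod_(i < m) g (widen_ord hm i) (widen_ord hm i).
Proof. by rewrite /fund_weight (big_ord_narrow hm). Qed.

Lemma upper_mul_delta (b : 'M[K]_N) (i : 'I_(k + 3)) : is_trig_mx b^T ->
  b *m delta_mx (std_index i) 0 =
  \sum_(j < k + 3) b (std_index j) (std_index i) *: delta_mx (std_index j) 0
  :> 'cV_N.
Proof.
move=> /is_trig_mxP hb; apply/colP => l.
rewrite -colE mxE summxE.
under eq_bigr do rewrite !mxE eqxx andbT.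
have [hl|hl] := ltnP l (k + 3).
  rewrite (bigD1 (Ordinal hl)) //= big1 => [|j jl].
    rewrite addr0 (_ : std_index (Ordinal hl) = l) ?eqxx ?mulr1 //.
    exact: val_inj.
  case: eqP => [e|]; rewrite ?mulr0 //; case/eqP: jl; apply: val_inj.
  by move/(congr1 val): e.
rewrite big1 => [|j _]; last first.
  by case: eqP => [e|]; rewrite ?mulr0 //; move: hl; rewrite e leqNgt /= ltn_ord.
have := hb (std_index i) l; rewrite mxE => -> //.
exact: leq_trans (ltn_ord i) hl.
Qed.

(** An upper triangular b preserves the standard flag, so [Efun_flag] applies with b_11, b_22 and
    the leading block of b. Invertibility is assumed rather than determinant 1 because scalar
    matrices and the upper factors of the big cell are used later. *)
Lemma act_upper_Estd (b : 'M[K]_N) : is_trig_mx b^T -> b \in unitmx ->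
  act b Estd = fun P => Omega K N k d b * Estd P.
Proof.
move=> tb ub; have bii i : b i i != 0.
  move: ub; rewrite unitmxE -det_tr det_trig // unitfE.
  by move/prodf_neq0/(_ i isT); rewrite mxE.
apply/funext => P; rewrite /Estd act_Efun.
set o0 := std_index (Ordinal lt0); set o1 := std_index (Ordinal lt1).
have /is_trig_mxP hb := tb.
have eu : b *m std_u = b o0 o0 *: std_u.
  rewrite /std_u tnth_mktuple upper_mul_delta // (bigD1 (Ordinal lt0)) //=.
  rewrite big1 ?addr0 // => j j0; have := hb o0 (std_index j).
  rewrite mxE => ->; rewrite ?scale0r // /= lt0n.
  by apply: contraNneq j0 => e; apply/eqP/val_inj.
have ev : b *m std_v = b o1 o1 *: std_v + b o0 o1 *: std_u.
  rewrite /std_u /std_v !tnth_mktuple upper_mul_delta // (bigD1 (Ordinal lt1)) //=.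
  rewrite (bigD1 (Ordinal lt0)) //= big1 ?addr0 // => j /andP [j1 j0].
  have := hb o1 (std_index j); rewrite mxE => ->; rewrite ?scale0r //=.
  rewrite ltn_neqAle lt0n; apply/andP; split.
    by apply: contraNneq j1 => e; apply/eqP/val_inj.
  by apply: contraNneq j0 => e; apply/eqP/val_inj.
pose C := \matrix_(i < k + 3, j < k + 3) b (std_index i) (std_index j).
rewrite eu ev (@Efun_flag _ std_frame _ _ P _ _ _ C) //; last first.
  move=> j; rewrite !tnth_mktuple upper_mul_delta //.
  by apply: eq_bigr => i _; rewrite !mxE tnth_mktuple.
congr (_ * _).
have -> : \det C = fund_weight (k + 3) b.
  rewrite -det_tr det_trig ?(fund_weightE _ hN).
    by apply: eq_bigr => i _; rewrite !mxE.
  apply/is_trig_mxP => i j ij; rewrite !mxE.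
  by have := hb (std_index i) (std_index j) ij; rewrite mxE.
have hN1 : (1 <= N)%N by apply: leq_trans hN; rewrite addnS.
have hN2 : (2 <= N)%N by apply: leq_trans hN; rewrite !addnS.
rewrite /Omega; have -> : fund_weight 1 b = b o0 o0.
  by rewrite (fund_weightE _ hN1) big_ord1; congr (b _ _); apply: val_inj.
have -> : fund_weight 2 b = b o0 o0 * b o1 o1.
  rewrite (fund_weightE _ hN2) !big_ord_recl big_ord0 mulr1.
  by congr (b _ _ * b _ _); apply: val_inj.
rewrite (exprMn _ (b o0 o0)) [RHS]mulrC [X in _ = _ * X]mulrA -exprD.
by congr (_ * (_ ^+ _ * _ ^+ _)); rewrite ?weight_exponent1 ?weight_exponent2.
Qed.

Lemma Omega_neq0 (b : 'M[K]_N) : (forall i, b i i != 0) ->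
  Omega K N k d b != 0.
Proof.
move=> b0; have h m : fund_weight m b != 0 by apply/prodf_neq0 => i _.
by rewrite /Omega !mulf_neq0 // expf_neq0.
Qed.

Lemma std_index_eq (i j : 'I_(k + 3)) : (std_index i == std_index j) = (i == j).
Proof. by apply/eqP/eqP => [/(congr1 val) /= h|->//]; apply: val_inj. Qed.

Lemma dirderiv_std (i l : 'I_(k + 3)) :
  dirderiv (tnth std_frame i) ('X_(std_index l) : {mpoly K[N]}) = (i == l)%:R.
Proof.
rewrite /dirderiv tnth_mktuple (bigD1 (std_index i)) //= big1 => [|j ji].
  rewrite !mxE !eqxx scale1r addr0 mderivX mnm1E std_index_eq eq_sym.
  case: eqP => [->|_]; last by rewrite scale0r.
  by rewrite scale1r submm mpolyX0.
by rewrite !mxE (negPf ji) scale0r.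
Qed.

Lemma dirderiv_exp w (p : {mpoly K[N]}) m :
  dirderiv w (p ^+ m) = m%:R * p ^+ m.-1 * dirderiv w p.
Proof.
elim: m => [|m IH].
  rewrite expr0 mul0r mul0r /dirderiv big1 // => i _.
  by rewrite -mpolyC1 mderivC scaler0.
rewrite exprS dirderivM IH /=; case: m {IH} => [|m]; first by rewrite expr0; ring.
by rewrite /= exprS [m.+2%:R]mulrS; ring.
Qed.

(* The witness is [x_0^(d-2) * (2 x_0 x_1 + x_2^2 + ... + x_(k+2)^2)]: it
   vanishes at e_0, where its Hessian along the frame is nonsingular. *)
Lemma Estd_neq0 : exists P, Estd P != 0.
Proof.
set o0 := Ordinal lt0; set o1 := Ordinal lt1.
have o01 : o0 != o1 by [].
(* Swapping the first two indices writes the quadric of the witness as one sum of [y l * y (s l)],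
   in which x_0 x_1 occurs twice. *)
set s := tperm o0 o1.
have sE i j : (s i == j) = (i == s j) by rewrite -{1}[j](tpermK o0 o1) (inj_eq perm_inj).
pose y l : {mpoly K[N]} := 'X_(std_index l).
pose m := (d - 2)%N.
pose q := \sum_l y l * y (s l); pose p := y o0 ^+ m * q.
have hy l : y l \is 1.-homog by rewrite dhomogX /= mdeg1.
have hp : p \is d.-homog.
  have -> : d = (1 * m + 2)%N by rewrite /m; lia.
  apply: dhomogM; first exact: dhomogMn.
  apply: rpred_sum => l _; exact: (dhomogM (hy l) (hy (s l))).
exists (DHomog hp).
have line_std l : line_poly std_u std_v (y l) =
    if l == o0 then 'X else (l == o1)%:R.
  rewrite line_polyX /std_u /std_v !tnth_mktuple !mxE !andbT !std_index_eq.
  case: (eqVneq l o0) => [->|_].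
    by rewrite (negPf o01) mul1r addr0.
  by rewrite mul0r add0r; case: eqP.
(* Only 2 x_0 x_1 survives on the line, so x^d is absent and [Eform_lead0] reduces E to a nonzero
   scalar times the Hessian determinant at e_0. *)
have lp : line_poly std_u std_v p = 2%:R *: 'X^(d.-1).
  rewrite /p /q rmorphM rmorphXn /= raddf_sum /= line_std eqxx.
  rewrite (bigD1 o0) //= (bigD1 o1) //= big1 => [|l /andP [l0 l1]]; last first.
    by rewrite rmorphM /= line_std (negPf l0) (negPf l1) mul0r.
  rewrite !rmorphM /= tpermL tpermR !line_std !eqxx /= addr0 mulr1 mul1r.
  rewrite -mulr2n mulrnAr -exprSr -scaler_nat /m.
  by congr (_ *: 'X^_); lia.
rewrite /Estd Efun_Eform /= lp Eform_lead0 ?leqW //; last first.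
  by rewrite coefZ coefXn; case: eqP => [|_]; rewrite ?mulr0 //; lia.
rewrite mulf_neq0 //; last first.
  by rewrite expf_neq0 // coefZ coefXn eqxx mulr1 oppr_eq0 pnatr_eq0.
rewrite (line_poly_lead _ _ (hess_det_homog _ hp)) /evalW /hess_det.
pose D i := dirderiv (tnth std_frame i).
have Dy i l : D i (y l) = (i == l)%:R by exact: dirderiv_std.
have DM i a b : D i (a * b) = D i a * b + a * D i b by exact: dirderivM.
have DD i a b : D i (a + b) = D i a + D i b by exact: linearD.
have Dq j : D j q = 2%:R * y (s j).
  rewrite /D /q linear_sum /=.
  have E l : dirderiv (tnth std_frame j) (y l * y (s l)) =
      (j == l)%:R * y (s l) + y l * (s j == l)%:R.
    by rewrite dirderivM -/(D j) !Dy sE.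
  rewrite (eq_bigr _ (fun l _ => E l)) big_split /=.
  rewrite (bigD1 j) //= big1 => [|l lj]; last by rewrite eq_sym (negPf lj) mul0r.
  rewrite (bigD1 (s j)) //= big1 => [|l lj]; last by rewrite eq_sym (negPf lj) mulr0.
  by rewrite !eqxx !addr0 mul1r mulr1 mulr_natl mulr2n.
have Dp i j : D i (D j p) = D i (D j (y o0 ^+ m)) * q
    + D j (y o0 ^+ m) * (2%:R * y (s i)) + D i (y o0 ^+ m) * (2%:R * y (s j))
    + y o0 ^+ m * (2%:R * (i == s j)%:R).
  have D2 l : D i (2%:R * y l) = 2%:R * (i == l)%:R.
    by rewrite -[2%:R]mpolyC_nat !mul_mpolyC /D linearZ /= -/(D i) Dy.
  by rewrite DM Dq DD DM (DM _ (y o0 ^+ m)) Dq D2; ring.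
pose ev := meval (fun i : 'I_N => std_u i 0).
have evy l : ev (y l) = (l == o0)%:R.
  by rewrite /ev mevalXU /std_u tnth_mktuple mxE andbT std_index_eq.
have evn a : ev a%:R = a%:R by rewrite /ev -mpolyC_nat mevalC.
have evM a b : ev (a * b) = ev a * ev b by exact: mevalM.
have evA a b : ev (a + b) = ev a + ev b by exact: mevalD.
have ev0 j : ev (y o0 ^+ j) = 1 by rewrite /ev rmorphXn /= -/ev evy eqxx expr1n.
have evq : ev q = 0.
  rewrite /ev raddf_sum big1 // => l _ /=; rewrite -/(ev _) evM !evy sE.
  case: eqP => [->|_]; rewrite ?mul0r // tpermL (negPf o01).
  by rewrite mulr0.
have evD j : ev (D j (y o0 ^+ m)) = m%:R * (j == o0)%:R.
  by rewrite /D dirderiv_exp -/(D j) Dy !evM ev0 !evn mulr1.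
(* At e_0 the Hessian is monomial: row i has its only nonzero entry in column [s i], equal to 2m + 2
   for the first two indices and to 2 for the others. *)
pose c i := ((m * (s i == o0) + m * (i == o0)) * 2 + 2)%N.
have evDD i j : ev (D i (D j p)) = (c i)%:R * (s i == j)%:R.
  rewrite Dp !evA !evM evq !evD !evy !evn ev0 -sE mulr0 add0r /c.
  case: (eqVneq (s i) j) => [<-|sij].
    have -> : s (s i) = i by rewrite /s tpermK.
    rewrite natrD natrM natrD !natrM.
    by case: (s i == o0); case: (i == o0) => /=; ring.
  have h : (j == o0) && (s i == o0) = false.
    by apply: contraNF sij => /andP [/eqP -> /eqP ->].
  have h' : (i == o0) && (s j == o0) = false.
    apply: contraNF sij => /andP [/eqP ->]; rewrite sE => /eqP ->.
    by rewrite tpermL.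
  rewrite !mulr0 addr0; move: h h'.
  by do 4! case: (_ == o0); rewrite //= ?(mulr0, mul0r, addr0).
have -> : (\det (\matrix_(i, j) dirderiv (tnth std_frame i)
    (dirderiv (tnth std_frame j) p))).@[std_u^~ 0] =
    \det (diag_mx (\row_i (c i)%:R) *m perm_mx s).
  rewrite -det_map_mx; congr (\det _); apply/matrixP => i j.
  rewrite mul_diag_mx !mxE; exact: evDD.
rewrite det_mulmx det_diag det_perm mulf_neq0 ?signr_eq0 //.
by apply/prodf_neq0 => i _; rewrite mxE pnatr_eq0 /c addnS.
Qed.

End EfunProperties.

(** * The orbit of the standard flag *)

Lemma extend_basis (F : fieldType) (V : vectType F) (U : {vspace V}) X :
  free X -> (<<X>> <= U)%VS -> exists Y, basis_of U (X ++ Y).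
Proof.
move=> fX sX; exists (vbasis (U :\: <<X>>)).
have {1}-> : U = (<<X>> + (U :\: <<X>>))%VS.
  by rewrite addvC addv_diff; apply/esym/addv_idPl.
apply: cat_basis; last exact: vbasisP.
  by apply/directv_addP; rewrite capvC capv_diff.
by rewrite /basis_of eqxx.
Qed.

Section FlagOrbit.
Variables (K : numClosedFieldType) (N k d : nat).
Hypotheses (hd : (3 <= d)%N) (hN : (k + 3 <= N)%N).
Implicit Types (u v w : 'cV[K]_N) (g : 'M[K]_N).
Implicit Types (f : (k + 3).-tuple 'cV[K]_N).

Local Notation E0 := (@Estd K N k d hN).

Lemma basis_matrix_unit (B : seq 'cV[K]_N) : basis_of fullv B ->
  \matrix_(i < N, j < N) (nth 0 B j) i 0 \in unitmx.
Proof.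
move=> hB; set g := \matrix_(i, j) _.
have sB : size B = N.
  rewrite -(vector.size_basis (X := in_tuple B) hB) dimvf -[RHS]muln1.
  exact: dim_matrix.
have hw w : exists c : 'cV[K]_N, w = g *m c.
  exists (\col_j coord (in_tuple B) (cast_ord (esym sB) j) w); apply/colP => i.
  have {1}-> := coord_basis (X := in_tuple B) hB (memvf w).
  rewrite summxE mxE (reindex (cast_ord (esym sB))) /=; last first.
    by exists (cast_ord sB) => j _; rewrite ?cast_ordK ?cast_ordKV.
  by apply: eq_bigr => j _; rewrite !mxE mulrC.
pose h j := xget 0 [set c : 'cV[K]_N | delta_mx j 0 = g *m c].
have hh j : delta_mx j 0 = g *m h j.
  by rewrite /h; case: xgetP => [_ -> //|]; case: (hw (delta_mx j 0)) => c hc /(_ c).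
have : g *m (\matrix_(i, j) h j i 0) = 1%:M.
  apply/matrixP => i j; have /colP/(_ i) := hh j; rewrite !mxE eqxx andbT => ->.
  by apply: eq_bigr => l _; rewrite !mxE.
by case/mulmx1_unit.
Qed.

(** Complete u, v to a basis of F and then of W; the matrix g with these columns carries the
    standard flag to the given one. Passing from f to the new basis of F costs a squared
    determinant, and rescaling g by an N-th root of 1 / det g, to land in SL_N, costs the value of
    [Omega] at a scalar matrix. *)
Lemma Efun_orbit f u v : free f -> u \in <<f>>%VS -> v \in <<f>>%VS ->
  free [:: u; v] ->
  exists c g, \det g = 1 /\ Efun (d := d) f u v = fun P => c * act g E0 P.
Proof.
move=> ff uf vf fuv.
have dimf : \dim <<f>>%VS = (k + 3)%N by have /eqnP -> := ff; rewrite size_tuple.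
have [Y1 hY1] : exists Y, basis_of <<f>>%VS ([:: u; v] ++ Y).
  apply: extend_basis => //; apply/span_subvP => w.
  by rewrite !inE => /orP [] /eqP ->.
set s := [:: u; v] ++ Y1 in hY1.
have ss : size s == (k + 3)%N.
  by rewrite -dimf (vector.size_basis (X := in_tuple s) hY1).
have [Y2 hB] := extend_basis (basis_free hY1) (subvf _).
set B := s ++ Y2 in hB.
pose g := \matrix_(i < N, j < N) (nth 0 B j) i 0.
have ug : g \in unitmx by exact: basis_matrix_unit.
pose st := Tuple ss.
have gs i : g *m tnth (std_frame K hN) i = tnth st i.
  rewrite tnth_mktuple -colE (tnth_nth 0); apply/colP => l; rewrite !mxE /=.
  by rewrite /B nth_cat (eqP ss) ltn_ord.
have [C hC] : exists C : 'M[K]_(k + 3), forall j,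
    tnth f j = \sum_i C i j *: tnth st i.
  exists (\matrix_(i, j) coord st i (tnth f j)) => j.
  have : tnth f j \in <<st>>%VS.
    by rewrite (span_basis hY1) memv_span // mem_tnth.
  move/coord_span => {1}->; apply: eq_bigr => i _.
  by rewrite mxE [tnth st i](tnth_nth 0).
have N0 : (0 < N)%N by apply: leq_trans hN; rewrite addnS.
have [t ht] : exists t : K, t ^+ N = (\det g)^-1.
  by exists (N.-root (\det g)^-1); rewrite rootCK.
have t0 : t != 0.
  apply: contraTneq ug => t0; move: ht; rewrite t0 expr0n eqn0Ngt N0.
  by move/esym/eqP; rewrite invr_eq0 unitmxE unitfE => /eqP ->; rewrite eqxx.
exists (\det C ^+ 2 / Omega K N k d t%:M), (g *m t%:M); split.
  by rewrite det_mulmx det_scalar ht divff // -unitfE -unitmxE.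
have eE : act g E0 = Efun st u v.
  have e1 : [tuple g *m tnth (std_frame K hN) i | i < k + 3] = st.
    by apply: eq_from_tnth => i; rewrite tnth_mktuple gs.
  have e2 : g *m std_u K hN = u by rewrite /std_u gs (tnth_nth 0).
  have e3 : g *m std_v K hN = v by rewrite /std_v gs (tnth_nth 0).
  by rewrite /Estd act_Efun e1 e2 e3.
apply/funext => P; rewrite act_mul (act_upper_Estd hd).
- have O0 : Omega K N k d t%:M != 0.
    by apply: Omega_neq0 => i; rewrite mxE eqxx.
  have := @Efun_flag K N k d hd f st u v P 1 1 0 C (oner_neq0 _) hC.
  rewrite !scale1r scale0r addr0 !expr1n !mulr1 => ->.
  transitivity (\det C ^+ 2 / Omega K N k d t%:M *
      (Omega K N k d t%:M * act g E0 P)); last by [].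
  by rewrite mulrA (divfK O0) [act g _]eE.
- by rewrite tr_scalar_mx scalar_mx_is_trig.
- by rewrite unitmxE det_scalar unitfE expf_neq0.
Qed.

Lemma Eset_act g phi : g \in unitmx -> Eset K N k d phi ->
  Eset K N k d (act g phi).
Proof.
move=> ug [f [u [v [ff uf vf fuv ->]]]].
have mem w : w \in <<f>>%VS ->
    g *m w \in <<[tuple g *m tnth f i | i < k + 3]>>%VS.
  move/coord_span ->; rewrite mulmx_sumr; apply: memv_suml => i _.
  rewrite -scalemxAr memvZ // memv_span //; apply/tnthP; exists i.
  by rewrite tnth_mktuple (tnth_nth 0).
have fr n (X : n.-tuple 'cV[K]_N) : free X -> free [tuple g *m tnth X i | i < n].
  move=> /freeP fX; apply/freeP => c hc; apply: fX.
  apply: (can_inj (mulKmx ug)); rewrite mulmx0 mulmx_sumr -[RHS]hc.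
  by apply: eq_bigr => i _; rewrite -!tnth_nth tnth_mktuple scalemxAr.
exists [tuple g *m tnth f i | i < k + 3], (g *m u), (g *m v).
split; [exact: fr|exact: mem|exact: mem| |exact: act_Efun].
have := fr _ [tuple u; v] fuv; congr (free _).
by rewrite /= !enum_ordSl (size0nil (size_enum_ord 0)).
Qed.

Lemma Estd_Eset : Eset K N k d E0.
Proof.
have h (i j : 'I_(k + 3)) :
    (tnth (std_frame K hN) i) (std_index hN j) 0 = (j == i)%:R.
  by rewrite tnth_mktuple mxE std_index_eq andbT.
have fs : free (std_frame K hN).
  apply/freeP => c hc i.
  have : (\sum_j c j *: tnth (std_frame K hN) j) (std_index hN i) 0 = 0.
    move/colP: hc => /(_ (std_index hN i)); rewrite [RHS]mxE => <-.
    by congr (fun_of_matrix _ _ _); apply: eq_bigr => j _; rewrite (tnth_nth 0).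
  rewrite summxE (bigD1 i) //= big1 => [|j ji]; rewrite mxE h.
    by rewrite eqxx mulr1 addr0.
  by rewrite eq_sym (negPf ji) mulr0.
exists (std_frame K hN), (std_u K hN), (std_v K hN); split=> //.
- by rewrite memv_span // mem_tnth.
- by rewrite memv_span // mem_tnth.
have [i [j [ij -> ->]]] := std_uv_frame K hN.
apply/(@freeP _ _ 2 [tuple tnth (std_frame K hN) i; tnth (std_frame K hN) j]).
move=> c; rewrite !big_ord_recl big_ord0 addr0 /= => hc.
have hl l : c ord0 * (l == i)%:R + c (lift ord0 ord0) * (l == j)%:R = 0.
  move/colP: hc => /(_ (std_index hN l)); rewrite [RHS]mxE => <-.
  by rewrite -!h mxE; congr (_ + _); rewrite mxE.
have := hl j; rewrite eqxx [j == i]eq_sym (negPf ij) mulr0 add0r mulr1 => c1.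
have := hl i; rewrite eqxx (negPf ij) mulr0 addr0 mulr1 => c0 l.
case: (unliftP ord0 l) => [m|] ->; last exact: c0.
by rewrite (ord1 m).
Qed.

End FlagOrbit.

(** * Polynomial functions on forms *)

Section Coordinates.
Variables (K : numClosedFieldType) (N d : nat).
Local Notation V := (dhomog N K d).
Implicit Types (P : V) (phi psi : V -> K).

Definition monomials : seq 'X_{1..N} :=
  [seq s2m t | t : d.-tuple 'I_N <- enum (basis N d)].

Definition mon (i : 'I_(size monomials)) : 'X_{1..N} := nth 0%MM monomials i.

Definition coords P (i : 'I_(size monomials)) : K := (P : {mpoly K[N]})@_(mon i).

Lemma mdeg_mon i : mdeg (mon i) = d.
Proof. by apply/eqP; rewrite basis_cover mem_nth. Qed.

Lemma mon_inj : injective mon.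
Proof.
move=> i j /eqP; rewrite nth_uniq ?uniq_basis // => /eqP h; exact: val_inj.
Qed.

Lemma mon_surj m : mdeg m = d -> exists i, m = mon i.
Proof.
move=> /eqP; rewrite basis_cover => hm.
by exists (Ordinal (etrans (index_mem _ _) hm)); rewrite /mon /= nth_index.
Qed.

Lemma mon_homog i : ('X_[mon i] : {mpoly K[N]}) \is d.-homog.
Proof. by rewrite dhomogX /= mdeg_mon. Qed.

Definition basis_form i : V := DHomog (mon_homog i).

Lemma coords_basis_form i j : coords (basis_form i) j = (i == j)%:R.
Proof. by rewrite /coords /= mcoeffX (inj_eq mon_inj). Qed.

Lemma coords_inj P Q : coords P =1 coords Q -> P = Q.
Proof.
move=> h; apply/val_inj/mpolyP => m /=.
have [/mon_surj [i ->]|dm] := eqVneq (mdeg m) d; first exact: h.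
have hc (A : V) : (A : {mpoly K[N]})@_m = 0.
  exact: (dhomog_nemf_coeff (dhomog_is_dhomog A) dm).
by rewrite !hc.
Qed.

Lemma coordsZ a P i : coords (a *: P) i = a * coords P i.
Proof. by rewrite /coords /= mcoeffZ. Qed.

Lemma coords_linear i : linear (fun P => coords P i : K^o).
Proof. by move=> a P Q; rewrite /coords /= mcoeffD mcoeffZ. Qed.

Lemma coords_sum (c : 'I_(size monomials) -> K) i :
  coords (\sum_j c j *: basis_form j) i = c i.
Proof.
have -> : coords (\sum_j c j *: basis_form j) i =
    \sum_j coords (c j *: basis_form j) i.
  apply: (big_morph (fun P => coords P i)) => [P Q|].
    by rewrite /coords /= mcoeffD.
  by rewrite /coords /= mcoeff0.
rewrite (bigD1 i) //= big1 => [|j ji]; rewrite coordsZ coords_basis_form.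
  by rewrite eqxx addr0 mulr1.
by rewrite (negPf ji) mulr0.
Qed.

Lemma basis_form_sum P : P = \sum_i coords P i *: basis_form i.
Proof. by apply: coords_inj => i; rewrite coords_sum. Qed.

(** Arbitrary linear forms are traded for the coefficients of P, which reduces closure properties
    and identities to those of polynomials. *)
Lemma homog_polyfunP m phi : homog_polyfun m phi <->
  exists2 p : {mpoly K[size monomials]}, p \is m.-homog &
    forall P, phi P = p.@[coords P].
Proof.
split=> [[n [l [p [hp hphi]]]]|[p hp hphi]]; last first.
  pose lM i := GRing.isLinear.Build _ _ _ _ _ (coords_linear i).
  pose l i : {linear V -> K^o} := HB.pack (fun P => coords P i : K^o) (lM i).
  by exists (size monomials), l, p.
exists (p \mPo [tuple \sum_i l j (basis_form i) *: 'X_i | j < n]).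
  apply: dhomog_comp => // j; rewrite tnth_mktuple.
  by apply: rpred_sum => i _; apply: rpredZ; rewrite dhomogX /= mdeg1.
move=> P; rewrite hphi comp_mpoly_meval; apply: meval_eq => j.
rewrite tnth_mktuple {1}[P]basis_form_sum linear_sum raddf_sum /=.
by apply: eq_bigr => i _; rewrite linearZ mevalZ mevalXU /= mulrC.
Qed.

Lemma polyfun_linear (l : V -> K) : linear (l : V -> K^o) -> homog_polyfun 1 l.
Proof.
move=> ll; pose lM := GRing.isLinear.Build _ _ _ _ _ ll.
pose lL : {linear V -> K^o} := HB.pack (l : V -> K^o) lM.
exists 1%N, (fun=> lL), 'X_ord0; split; first by rewrite dhomogX /= mdeg1.
by move=> P; rewrite mevalXU.
Qed.

Lemma polyfun_const c : homog_polyfun 0 (fun _ : V => c).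
Proof.
exists 0%N, (fun=> \0), c%:MP; split; last by move=> P; rewrite mevalC.
by rewrite -[c%:MP]mulr1 mul_mpolyC; apply: rpredZ; apply: dhomog1.
Qed.

Lemma polyfun0 m : homog_polyfun m (fun _ : V => 0).
Proof.
by exists 0%N, (fun=> \0), 0; split; [exact: dhomog0 | move=> P; rewrite meval0].
Qed.

Lemma polyfunD m phi psi : homog_polyfun m phi -> homog_polyfun m psi ->
  homog_polyfun m (fun P => phi P + psi P).
Proof.
move=> /homog_polyfunP [p hp ep] /homog_polyfunP [q hq eq].
apply/homog_polyfunP; exists (p + q); first exact: rpredD.
by move=> P; rewrite mevalD ep eq.
Qed.

Lemma polyfunM m n phi psi : homog_polyfun m phi -> homog_polyfun n psi ->
  homog_polyfun (m + n) (fun P => phi P * psi P).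
Proof.
move=> /homog_polyfunP [p hp ep] /homog_polyfunP [q hq eq].
apply/homog_polyfunP; exists (p * q); first exact: dhomogM.
by move=> P; rewrite mevalM ep eq.
Qed.

Lemma polyfun_scale m c phi : homog_polyfun m phi ->
  homog_polyfun m (fun P => c * phi P).
Proof. exact: (polyfunM (polyfun_const c)). Qed.

Lemma polyfun_sum m (I : Type) (r : seq I) (A : pred I) (F : I -> V -> K) :
  (forall i, A i -> homog_polyfun m (F i)) ->
  homog_polyfun m (fun P => \sum_(i <- r | A i) F i P).
Proof.
move=> hF; elim: r => [|i r IH].
  by under eq_fun do rewrite big_nil; exact: polyfun0.
under eq_fun do rewrite big_cons.
by case Ai: (A i) => //; apply: polyfunD => //; exact: hF.
Qed.

Lemma polyfun_prod m (n : nat) (F : 'I_n -> V -> K) :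
  (forall i, homog_polyfun m (F i)) ->
  homog_polyfun (n * m) (fun P => \prod_i F i P).
Proof.
elim: n F => [|n IH] F hF.
  by under eq_fun do rewrite big_ord0; exact: polyfun_const.
by under eq_fun do rewrite big_ord_recl; apply: polyfunM => //; exact: IH.
Qed.

Lemma polyfun_exp m n phi : homog_polyfun m phi ->
  homog_polyfun (n * m) (fun P => phi P ^+ n).
Proof.
move=> h; have := polyfun_prod (F := fun _ : 'I_n => phi) (fun=> h).
by under eq_fun do rewrite prodr_const card_ord.
Qed.

Definition polyfun_poly m (F : V -> {poly K}) : Prop :=
  forall i, homog_polyfun m (fun P => (F P)`_i).

Lemma polyfun_poly_prod m n (F : 'I_n -> V -> {poly K}) :
  (forall i, polyfun_poly m (F i)) ->
  polyfun_poly (n * m) (fun P => \prod_i F i P).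
Proof.
elim: n F => [|n IH] F hF i.
  under eq_fun do rewrite big_ord0 coef1; exact: polyfun_const.
under eq_fun do rewrite big_ord_recl coefM.
apply: polyfun_sum => j _; apply: polyfunM; first exact: hF.
by apply: IH => l; exact: hF.
Qed.

Lemma polyfun_poly_det m n (A : V -> 'M[{poly K}]_n) :
  (forall i j, polyfun_poly m (fun P => A P i j)) ->
  polyfun_poly (n * m) (fun P => \det (A P)).
Proof.
move=> hA i; rewrite /determinant; under eq_fun do rewrite coef_sum.
apply: polyfun_sum => s _.
have -> : (fun P => ((-1) ^+ s * \prod_j A P j (s j))`_i) =
    fun P => (-1) ^+ s * (\prod_j A P j (s j))`_i.
  by apply/funext => P; rewrite !mulr_sign; case: ifP; rewrite ?coefN.
by apply: polyfun_scale; apply: polyfun_poly_prod => j; exact: hA.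
Qed.

Lemma line_poly_coef_polyfun (G : {mpoly K[N]} -> {mpoly K[N]}) u v i :
  linear G -> homog_polyfun 1 (fun P : V => (line_poly u v (G P))`_i).
Proof.
move=> lG; apply: polyfun_linear => a P Q.
by rewrite lG rmorphD /= line_polyZ coefD coefZ.
Qed.

(** Each term has degree k + 3 in P from Q_f and r + (e + 1 - d - r) from the p_j, which adds up to
    (k+2)(d-1). *)
Lemma Efun_polyfun k (f : (k + 3).-tuple 'cV[K]_N) u v : (3 <= d)%N ->
  homog_polyfun ((k + 2) * (d - 1)) (Efun (d := d) f u v).
Proof.
move=> hd; have -> : Efun f u v = fun P : V => Eform d ((k + 3) * (d - 2))
    (line_poly u v P) (line_poly u v (hess_det f P)).
  by apply/funext => P; exact: Efun_Eform.
have hp i : homog_polyfun 1 (fun P : V => (line_poly u v P)`_i).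
  exact: (@line_poly_coef_polyfun id).
have hq : polyfun_poly (k + 3) (fun P : V => line_poly u v (hess_det f P)).
  have -> : (fun P : V => line_poly u v (hess_det f P)) =
      fun P => \det (\matrix_(i < k + 3, j < k + 3)
        line_poly u v (dirderiv (tnth f i) (dirderiv (tnth f j) P))).
    apply/funext => P; rewrite -det_map_mx; congr (\det _).
    by apply/matrixP => i j; rewrite !mxE.
  rewrite -[X in polyfun_poly X _]muln1; apply: polyfun_poly_det => i j l.
  under eq_fun do rewrite mxE.
  apply: (line_poly_coef_polyfun (G := fun p : {mpoly K[N]} =>
    dirderiv (tnth f i) (dirderiv (tnth f j) p))).
  by move=> a p q; rewrite !linearP.
rewrite /Eform; under eq_fun do rewrite big_nat.
apply: polyfun_sum => i /andP [_ hi]; apply: polyfun_sum => r _.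
apply: polyfun_sum => j _.
have hr : (r <= ((k + 3) * (d - 2)).+1 - d)%N.
  by have := ltn_ord r; rewrite ltnS => /leq_trans -> //; apply: leq_sub2r.
have -> : ((k + 2) * (d - 1) =
    0 + (k + 3) + r * 1 + (((k + 3) * (d - 2)).+1 - d - r) * 1)%N.
  rewrite !muln1 add0n -addnA subnKC //.
  have -> : d = (d - 3 + 3)%N by lia.
  move: (d - 3)%N => c; have -> : (c + 3 - 2 = c + 1)%N by lia.
  have -> : (c + 3 - 1 = c + 2)%N by lia.
  by nia.
apply: polyfunM; last exact: polyfun_exp.
apply: polyfunM; last by apply: polyfun_prod => s; exact: hp.
by apply: polyfunM; [exact: polyfun_const | exact: hq].
Qed.

End Coordinates.

(** * The Fischer form *)

Section FischerForm.
Variables (K : numClosedFieldType) (n : nat) (w : 'I_n -> K).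
Hypothesis w_gt0 : forall i, 0 < w i.
Implicit Types (p q : {mpoly K[n]}) (m : 'X_{1..n}).

(** The squared norm of a monomial; distinct monomials are orthogonal. The weights w make the same
    form usable both on W and on the coefficient space of S^d W^*. *)
Definition fischer_weight m : K := \prod_i ((m i)`!%:R * w i ^+ m i).

Definition fischer p q : K :=
  \sum_(m <- msupp p) p@_m * ((q@_m)^* * fischer_weight m).

Local Notation B := fischer.

Lemma fischer_weight_gt0 m : 0 < fischer_weight m.
Proof.
apply: prodr_gt0 => i _; apply: mulr_gt0; first by rewrite ltr0n fact_gt0.
exact: exprn_gt0.
Qed.

Lemma fischerE k p q : (msize p <= k)%N ->
  B p q = \sum_(m : 'X_{1..n < k}) p@_m * ((q@_m)^* * fischer_weight m).
Proof.
move=> le_pk; rewrite /fischer; pose I : subFinType _ := 'X_{1..n < k}.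
rewrite (ssrcomplements.big_mksub I) ?msupp_uniq //=; last first.
  by move=> m /msize_mdeg_lt /leq_trans; apply.
rewrite big_rmcond //= => m /memN_msupp_eq0 ->.
by rewrite mul0r.
Qed.

Lemma fischerDl p1 p2 q : B (p1 + p2) q = B p1 q + B p2 q.
Proof.
pose k := (msize p1 + msize p2)%N.
rewrite !(@fischerE k) ?leq_addr ?leq_addl //; last first.
  by apply: leq_trans (msizeD_le _ _) _; rewrite geq_max leq_addr leq_addl.
by rewrite -big_split; apply: eq_bigr => m _ /=; rewrite mcoeffD mulrDl.
Qed.

Lemma fischerZl c p q : B (c *: p) q = c * B p q.
Proof.
rewrite !(@fischerE (msize p)) ?msizeZ_le // mulr_sumr.
by apply: eq_bigr => m _; rewrite mcoeffZ -mulrA.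
Qed.

Lemma fischerC p q : B p q = (B q p)^*.
Proof.
pose k := (msize p + msize q)%N.
rewrite !(@fischerE k) ?leq_addr ?leq_addl // rmorph_sum; apply: eq_bigr => m _ /=.
rewrite !rmorphM /= conjCK [(fischer_weight m)^*]conj_Creal; first by ring.
by rewrite realE ltW ?fischer_weight_gt0.
Qed.

Lemma fischerDr p q1 q2 : B p (q1 + q2) = B p q1 + B p q2.
Proof. by rewrite fischerC fischerDl rmorphD /= -!fischerC. Qed.

Lemma fischerZr c p q : B p (c *: q) = c^* * B p q.
Proof. by rewrite fischerC fischerZl rmorphM /= -fischerC. Qed.

Lemma fischer0l q : B 0 q = 0.
Proof. by rewrite /fischer msupp0 big_nil. Qed.

Lemma fischer0r p : B p 0 = 0.
Proof. by rewrite fischerC fischer0l rmorph0. Qed.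

Lemma fischer_suml (I : Type) (r : seq I) (F : I -> {mpoly K[n]}) q :
  B (\sum_(i <- r) F i) q = \sum_(i <- r) B (F i) q.
Proof.
by apply: (big_morph (B^~ q)) => [p1 p2|]; [exact: fischerDl | exact: fischer0l].
Qed.

Lemma fischer_sumr (I : Type) (r : seq I) (F : I -> {mpoly K[n]}) p :
  B p (\sum_(i <- r) F i) = \sum_(i <- r) B p (F i).
Proof.
by apply: (big_morph (B p)) => [q1 q2|]; [exact: fischerDr | exact: fischer0r].
Qed.

Lemma fischer_eq0 p : B p p = 0 -> p = 0.
Proof.
rewrite (@fischerE (msize p)) // => h; apply/mpolyP => m; rewrite mcoeff0.
have [hm|hm] := ltnP (mdeg m) (msize p); last first.
  by apply: memN_msupp_eq0; apply: msize_mdeg_ge.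
have ge0 (l : 'X_{1..n < msize p}) :
    0 <= p@_l * ((p@_l)^* * fischer_weight l).
  by rewrite mulrA mulr_ge0 ?mul_conjC_ge0 // ltW ?fischer_weight_gt0.
move/eqP: h; rewrite psumr_eq0 // => /allP /(_ (BMultinom hm)).
rewrite mem_index_enum => /(_ isT) /=.
rewrite mulrA mulf_eq0 (gt_eqF (fischer_weight_gt0 m)) orbF mul_conjC_eq0.
by move/eqP.
Qed.

Lemma fischer_X m q : B 'X_[m] q = (q@_m)^* * fischer_weight m.
Proof. by rewrite /fischer msuppX big_seq1 mcoeffX eqxx mul1r. Qed.

Lemma fischer_weight_succ m i :
  fischer_weight (m + U_(i)) = (m i).+1%:R * w i * fischer_weight m.
Proof.
rewrite /fischer_weight (bigD1 i) //= [in RHS](bigD1 i) //= mulrA.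
congr (_ * _).
  by rewrite mnmDE mnm1E eqxx addn1 factS natrM exprS; ring.
by apply: eq_bigr => j ji; rewrite mnmDE mnm1E eq_sym (negPf ji) addn0.
Qed.

Lemma fischer_mulX i p q : B ('X_i * p) q = w i * B p q^`M(i).
Proof.
elim/mpolyind: p => [|c m p _ _ IH]; first by rewrite mulr0 !fischer0l mulr0.
rewrite mulrDr !fischerDl IH mulrDr -scalerAr !fischerZl; congr (_ + _).
rewrite -mpolyXD [(U_(i) + m)%MM]addmC !fischer_X mcoeff_deriv.
have -> : (q@_(m + U_(i)) *+ (m i).+1)^* = (m i).+1%:R * (q@_(m + U_(i)))^*.
  by rewrite rmorphMn mulr_natl.
by rewrite fischer_weight_succ; ring.
Qed.

Lemma mpoly_mulX_ind (Q : {mpoly K[n]} -> Prop) :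
  Q 1 -> (forall c p, Q p -> Q (c *: p)) ->
  (forall p q, Q p -> Q q -> Q (p + q)) ->
  (forall i p, Q p -> Q ('X_i * p)) -> forall p, Q p.
Proof.
move=> h1 hZ hD hX p; rewrite -[p]mulr1; move: 1 h1 => r.
elim/mpoly_alg_ind: p r => [c|i|p q hp hq|p q hp hq] r hr.
- by rewrite mul_mpolyC; apply: hZ.
- exact: hX.
- by rewrite mulrDl; apply: hD; [exact: hp | exact: hq].
- by rewrite -mulrA; apply: hp; exact: hq.
Qed.

Lemma mcoeff0_lin_subst (A : 'M[K]_n) q : (q \mPo lin_subst A)@_0 = q@_0.
Proof.
elim/mpoly_alg_ind: q => [c|i|p q hp hq|p q hp hq].
- by rewrite comp_mpolyC.
- rewrite comp_mpolyXU -tnth_nth tnth_mktuple mcoeffX raddf_sum /=.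
  rewrite mnm1_eq0 big1 // => j _; rewrite mcoeffZ mcoeffX mnm1_eq0.
  by rewrite mulr0.
- by rewrite comp_mpolyD !mcoeffD hp hq.
- by rewrite rmorphM /= !(rmorphM (mcoeff 0)) /= hp hq.
Qed.

(* Induction on p: multiplication by X_i is adjoint to w_i d_i. *)
Lemma fischer_adjoint (A A' : 'M[K]_n) :
  (forall i j, A i j * w j = w i * (A' j i)^*) ->
  forall p q, B (p \mPo lin_subst A) q = B p (q \mPo lin_subst A').
Proof.
move=> hA; elim/mpoly_mulX_ind => [|c p hp|p1 p2 hp1 hp2|i p hp] q.
- by rewrite comp_mpoly1 -mpolyX0 !fischer_X mcoeff0_lin_subst.
- by rewrite comp_mpolyZ !fischerZl hp.
- by rewrite comp_mpolyD !fischerDl hp1 hp2.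
(* Each X_j produced by the substitution crosses the form as w_j d_j; the hypothesis converts A_ij
   w_j, and the chain rule reassembles the derivative of the substituted q. *)
rewrite rmorphM /= comp_mpolyXU -tnth_nth tnth_mktuple mulr_suml fischer_suml.
rewrite fischer_mulX mderiv_comp fischer_sumr mulr_sumr; apply: eq_bigr => j _.
rewrite -scalerAl fischerZl fischer_mulX hp tnth_mktuple mderiv_lin_form.
by rewrite [X in _ = _ * B p X]mulrC mul_mpolyC fischerZr !mulrA hA.
Qed.

End FischerForm.

(** * Orthogonal projection onto a space of forms *)

Section OrthogonalProjection.
Variables (K : numClosedFieldType) (n D : nat) (w : 'I_n -> K).
Hypothesis w_gt0 : forall i, 0 < w i.
Variable L : set {mpoly K[n]}.
Hypothesis L_homog : forall p, L p -> p \is D.-homog.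
Hypothesis L0 : L 0.
Hypothesis L_lin : forall (a b : K) p q, L p -> L q -> L (a *: p + b *: q).

Local Notation B := (fischer w).

Let orthogonal_family r (f : 'I_r -> {mpoly K[n]}) : Prop :=
  [/\ forall i, L (f i), forall i, f i != 0 &
      forall i j, i != j -> B (f i) (f j) = 0].

Lemma lin_closed_sum r (c : 'I_r -> K) (f : 'I_r -> {mpoly K[n]}) :
  (forall i, L (f i)) -> L (\sum_i c i *: f i).
Proof.
move=> hf; elim/big_ind: _ => [|p q hp hq|i _]; first exact: L0.
  by have := L_lin 1 1 hp hq; rewrite !scale1r.
by have := L_lin (c i) 0 (hf i) L0; rewrite scale0r addr0.
Qed.

(** A longer family would have linearly dependent coefficient rows; pairing the dependency with each
    member kills its coefficients. *)
Lemma orthogonal_family_le r f : @orthogonal_family r f ->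
  (r <= size (monomials n D))%N.
Proof.
move=> [hL h0 ho]; rewrite leqNgt; apply/negP => hr.
pose X : 'M[K]_(r, size (monomials n D)) := \matrix_(i, j) (f i)@_(mon j).
have : ~~ row_free X.
  by rewrite /row_free neq_ltn (leq_ltn_trans (rank_leq_col X)).
rewrite -kermx_eq0 => /rowV0Pn [v /sub_kermxP vX v0].
case/negP: v0; apply/eqP/rowP => j; rewrite mxE.
have s0 : \sum_i v 0 i *: f i = 0.
  have hs : L (\sum_i v 0 i *: f i) by exact: lin_closed_sum.
  apply/mpolyP => m; rewrite mcoeff0.
  have [/mon_surj [l ->]|dm] := eqVneq (mdeg m) D; last first.
    exact: (dhomog_nemf_coeff (L_homog hs) dm).
  rewrite raddf_sum /=; have /rowP/(_ l) := vX; rewrite !mxE => e.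
  by rewrite -[RHS]e; apply: eq_bigr => i _; rewrite mcoeffZ mxE.
have := congr1 (B^~ (f j)) s0; rewrite fischer_suml fischer0l (bigD1 j) //=.
rewrite big1 => [|i ij]; rewrite fischerZl; last by rewrite ho // mulr0.
rewrite addr0 => /eqP; rewrite mulf_eq0 => /orP [/eqP //|/eqP /(fischer_eq0 w_gt0)].
by move/eqP; rewrite (negPf (h0 j)).
Qed.

(** Project along an orthogonal family in L of maximal length. If some l in L differed from its own
    projection, the difference would extend the family. *)
Lemma fischer_projection p :
  exists2 a, L a & forall l, L l -> B (p - a) l = 0.
Proof.
pose good r := `[< exists f, @orthogonal_family r f >].
have ex0 : exists r, good r.
  by exists 0%N; apply/asboolP; exists (fun=> 0); split=> -[].
have bd r : good r -> (r <= size (monomials n D))%N.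
  by move=> /asboolP [f /orthogonal_family_le].
case: (ex_maxnP ex0 bd) => r /asboolP [f [hL h0 ho]] mr.
pose pr q := \sum_i (B q (f i) / B (f i) (f i)) *: f i.
have Lpr q : L (pr q) by exact: lin_closed_sum.
have ff i : B (f i) (f i) != 0.
  by apply: contra_neq (h0 i); exact: fischer_eq0.
have orth q i : B (q - pr q) (f i) = 0.
  rewrite -scaleN1r fischerDl fischerZl /pr fischer_suml (bigD1 i) //=.
  rewrite big1 => [|j ji]; rewrite fischerZl; last by rewrite (ho _ _ ji) mulr0.
  by rewrite divfK // addr0 mulN1r subrr.
exists (pr p) => // l Ll.
have [el|nl] := eqVneq (l - pr l) 0.
  have -> : l = pr l by apply/eqP; rewrite -subr_eq0 el.
  rewrite [pr l]/pr (fischer_sumr w_gt0) big1 // => i _.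
  by rewrite (fischerZr w_gt0) orth mulr0.
have hl : L (l - pr l).
  by have := L_lin 1 (-1) Ll (Lpr l); rewrite scale1r scaleN1r.
have /mr : good r.+1; last by rewrite ltnn.
apply/asboolP; exists (fun i => if unlift ord0 i is Some j then f j else l - pr l).
split=> [i|i|i j].
- by case: unliftP.
- by case: unliftP.
case: unliftP => [i'|] ->; case: unliftP => [j'|] -> ij.
- by apply: ho; apply: contraNneq ij => ->.
- by rewrite (fischerC w_gt0) orth rmorph0.
- exact: orth.
- by rewrite eqxx in ij.
Qed.

End OrthogonalProjection.

(** * Triangular factorization of shifted matrices *)

Section BigCell.
Variable K : numClosedFieldType.

(** Block elimination starting from the lower right corner: [delta] is the product of the trailing
    principal minors of [g + s], each a characteristic polynomial in s and so nonzero. *)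
Lemma scalar_shift_UL n (g : 'M[K]_n) : exists2 delta : {poly K}, delta != 0 &
  forall s, delta.[s] != 0 -> exists u l : 'M[K]_n,
    [/\ is_trig_mx u^T, forall i, u i i = 1, is_trig_mx l, l \in unitmx &
        g + s%:M = u *m l].
Proof.
elim: n g => [|n IH] g.
  exists 1; first exact: oner_neq0.
  move=> s _; exists 1%:M, 1%:M; split; rewrite ?unitmx1 ?trmx1 //.
  - by move=> i; rewrite mxE eqxx.
  - by apply/matrixP => -[].
pose g' : 'M[K]_(1 + n) := g.
have [delta d0 hd] := IH (drsubmx g').
exists (delta * char_poly (- g)).
  by rewrite mulf_neq0 // monic_neq0 // char_poly_monic.
move=> s; rewrite hornerM mulf_eq0 negb_or => /andP [ds cs].
have ug : g + s%:M \in unitmx.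
  rewrite unitmxE unitfE; move: cs; rewrite /char_poly -horner_evalE -det_map_mx.
  suff -> : map_mx (horner_eval s) (char_poly_mx (- g)) = g + s%:M by [].
  apply/matrixP => i j; rewrite !mxE /horner_eval hornerD hornerN hornerC.
  by rewrite hornerMn hornerX opprK addrC.
have [u [l [tu u1 tl ul eq]]] := hd s ds.
have uu : u \in unitmx.
  rewrite -unitmx_tr unitmxE det_trig // unitfE; apply/prodf_neq0 => i _.
  by rewrite mxE u1 oner_neq0.
pose r := ursubmx g'; pose c := dlsubmx g'.
pose x := r *m invmx l; pose y := invmx u *m c.
pose U : 'M[K]_(1 + n) := block_mx 1%:M x 0 u.
pose A : 'M[K]_(1 + n) := block_mx (ulsubmx g' + s%:M - x *m y) 0 y l.
have e : g' + s%:M = U *m A.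
  rewrite mulmx_block !mul1mx !mul0mx !add0r subrK.
  rewrite /x /y mulmxKV // mulmxA mulmxV // mul1mx -eq.
  by rewrite -[g' in LHS]submxK (scalar_mx_block 1 n) add_block_mx !addr0.
have tU : is_trig_mx U^T.
  by rewrite tr_block_mx is_trig_block_mx // trmx0 eqxx tr_scalar_mx tu
     scalar_mx_is_trig.
have U1 (i : 'I_(1 + n)) : U i i = 1.
  case: (split_ordP i) => j ->; first by rewrite block_mxEul mxE eqxx.
  by rewrite block_mxEdr u1.
have tA : is_trig_mx A.
  rewrite is_trig_block_mx // eqxx tl andbT.
  by apply/is_trig_mxP => i j; rewrite !ord1.
exists U, A; split=> //.
have : U *m A \in unitmx by rewrite -e.
by rewrite unitmx_mul => /andP [].
Qed.

(** Conjugation by the antidiagonal permutation. It exchanges upper and lower triangular matrices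
    and so turns the UL factorization into an LU one. *)
Definition rev_mx n (g : 'M[K]_n) : 'M[K]_n :=
  \matrix_(i, j) g (rev_ord i) (rev_ord j).

Lemma rev_mxM n (g h : 'M[K]_n) : rev_mx (g *m h) = rev_mx g *m rev_mx h.
Proof.
apply/matrixP => i j; rewrite !mxE (reindex_inj rev_ord_inj) /=.
by apply: eq_bigr => l _; rewrite !mxE.
Qed.

Lemma rev_mx_trig n (g : 'M[K]_n) : is_trig_mx g -> is_trig_mx (rev_mx g)^T.
Proof.
move=> /is_trig_mxP h; apply/is_trig_mxP => i j ij; rewrite !mxE h //=.
by have := ltn_ord j; lia.
Qed.

Lemma scalar_shift_LU n (g : 'M[K]_n) : exists2 delta : {poly K}, delta != 0 &
  forall s, delta.[s] != 0 -> exists l u : 'M[K]_n,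
    [/\ is_trig_mx l, \det l = 1, is_trig_mx u^T, u \in unitmx &
        g + s%:M = l *m u].
Proof.
have [delta d0 hd] := scalar_shift_UL (rev_mx g).
exists delta => // s /hd [u [l [tu u1 tl ul e]]].
have tu' : is_trig_mx (rev_mx u).
  have := rev_mx_trig tu; congr is_trig_mx.
  by apply/matrixP => i j; rewrite !mxE.
exists (rev_mx u), (rev_mx l); split=> //.
- by rewrite det_trig // big1 // => i _; rewrite mxE u1.
- exact: rev_mx_trig.
- have : rev_mx l *m rev_mx (invmx l) = 1%:M.
    rewrite -rev_mxM mulmxV //; apply/matrixP => i j.
    by rewrite !mxE (inj_eq rev_ord_inj).
  by case/mulmx1_unit.
- rewrite -rev_mxM -e; apply/matrixP => i j.
  by rewrite !mxE !rev_ordK (inj_eq rev_ord_inj).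
Qed.

End BigCell.

(** * Functions polynomial in one parameter *)

Section PolynomialCurves.
Variable K : numClosedFieldType.
Implicit Types F G : K -> K.

Definition poly_fun F : Prop := exists q : {poly K}, forall s, F s = q.[s].

Lemma poly_fun_const c : poly_fun (fun=> c).
Proof. by exists c%:P => s; rewrite hornerC. Qed.

Lemma poly_fun_id : poly_fun id.
Proof. by exists 'X => s; rewrite hornerX. Qed.

Lemma poly_funD F G : poly_fun F -> poly_fun G -> poly_fun (fun s => F s + G s).
Proof. by move=> [p hp] [q hq]; exists (p + q) => s; rewrite hornerD hp hq. Qed.

Lemma poly_funM F G : poly_fun F -> poly_fun G -> poly_fun (fun s => F s * G s).
Proof. by move=> [p hp] [q hq]; exists (p * q) => s; rewrite hornerM hp hq. Qed.

Lemma poly_fun_sum (I : Type) (r : seq I) (A : pred I) (F : I -> K -> K) :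
  (forall i, poly_fun (F i)) -> poly_fun (fun s => \sum_(i <- r | A i) F i s).
Proof.
move=> hF; elim: r => [|i r IH].
  by under eq_fun do rewrite big_nil; exact: poly_fun_const.
under eq_fun do rewrite big_cons.
by case: (A i) => //; apply: poly_funD.
Qed.

Lemma poly_fun_eq0 F (delta : {poly K}) : poly_fun F -> delta != 0 ->
  (forall s, delta.[s] != 0 -> F s = 0) -> forall s, F s = 0.
Proof.
move=> [q hq] d0 h s; rewrite hq; suff -> : q = 0 by rewrite horner0.
have : q * delta = 0.
  apply: poly_eq0_nat => m; rewrite hornerM.
  have [->|ds] := eqVneq delta.[m%:R] 0; first by rewrite mulr0.
  by rewrite -hq h // mul0r.
by move/eqP; rewrite mulf_eq0 (negPf d0) orbF => /eqP.
Qed.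

Lemma poly_fun_comp n l (p : {mpoly K[n]}) (t : K -> n.-tuple {mpoly K[l]}) :
  (forall i m, poly_fun (fun s => (tnth (t s) i)@_m)) ->
  forall m, poly_fun (fun s => (p \mPo t s)@_m).
Proof.
move=> ht; elim/mpoly_alg_ind: p => [c|i|p q hp hq|p q hp hq] m.
- by under eq_fun do rewrite comp_mpolyC; exact: poly_fun_const.
- by under eq_fun do rewrite comp_mpolyXU -tnth_nth; exact: ht.
- by under eq_fun do rewrite comp_mpolyD mcoeffD; exact: poly_funD.
- under eq_fun do rewrite rmorphM /= mcoeffM.
  by apply: poly_fun_sum => i; apply: poly_funM.
Qed.

Lemma poly_fun_lin_subst n (M : K -> 'M[K]_n) (p : {mpoly K[n]}) :
  (forall i j, poly_fun (fun s => M s i j)) ->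
  forall m, poly_fun (fun s => (p \mPo lin_subst (M s))@_m).
Proof.
move=> hM; apply: poly_fun_comp => i m.
under eq_fun do rewrite tnth_mktuple raddf_sum /=.
apply: poly_fun_sum => j; under eq_fun do rewrite mcoeffZ.
by apply: poly_funM; [exact: hM | exact: poly_fun_const].
Qed.

End PolynomialCurves.

(** * The action on polynomials in the coefficients, and its adjoint *)

Section CoordinateAction.
Variables (K : numClosedFieldType) (N d : nat).
Local Notation V := (dhomog N K d).
Local Notation n := (size (monomials N d)).
Implicit Types (g h : 'M[K]_N) (p q : {mpoly K[n]}) (P : V).

Definition coord_mx g : 'M[K]_n :=
  \matrix_(i, j) (('X_[mon j] : {mpoly K[N]}) \mPo lin_subst g)@_(mon i).

Definition pact g p : {mpoly K[n]} := p \mPo lin_subst (coord_mx g).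

Lemma coords_pullback g P i :
  coords (pullback g P) i = \sum_j coord_mx g i j * coords P j.
Proof.
have e : (P : {mpoly K[N]}) = \sum_j coords P j *: 'X_[mon j].
  by rewrite {1}[P]basis_form_sum raddf_sum.
have -> : coords (pullback g P) i = (\sum_j coords P j *:
    (('X_[mon j] : {mpoly K[N]}) \mPo lin_subst g))@_(mon i).
  rewrite [LHS]/coords /= {1}e (raddf_sum (comp_mpoly (lin_subst g))) /=.
  by congr (_@_ _); apply: eq_bigr => j _; rewrite comp_mpolyZ.
by rewrite raddf_sum; apply: eq_bigr => j _ /=; rewrite mcoeffZ mxE mulrC.
Qed.

Lemma meval_pact g p P : (pact g p).@[coords P] = p.@[coords (pullback g P)].
Proof.
rewrite comp_mpoly_meval; apply: meval_eq => i.
rewrite tnth_mktuple raddf_sum coords_pullback; apply: eq_bigr => j _ /=.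
by rewrite mevalZ mevalXU.
Qed.

Lemma meval_coords_inj p q : (forall P : V, p.@[coords P] = q.@[coords P]) ->
  p = q.
Proof.
move=> h; apply/eqP; rewrite -subr_eq0; apply/eqP/mpoly_eq0_meval => x.
have -> : (p - q).@[x] = (p - q).@[coords (\sum_j x j *: basis_form K j)].
  by apply: meval_eq => i; rewrite coords_sum.
by rewrite mevalB h subrr.
Qed.

Lemma pact_mul g h p : pact (g *m h) p = pact g (pact h p).
Proof.
apply: meval_coords_inj => P.
rewrite [RHS](meval_pact g (pact h p) P).
rewrite [RHS](meval_pact h p (pullback g P)) pullback_mul.
exact: meval_pact.
Qed.

Lemma pact_homog D g p : p \is D.-homog -> pact g p \is D.-homog.
Proof.
move=> hp; apply: dhomog_comp => // i; rewrite tnth_mktuple.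
by apply: rpred_sum => j _; apply: rpredZ; rewrite dhomogX /= mdeg1.
Qed.

Definition adj_mx g : 'M[K]_N := (map_mx Num.conj g)^T.

Lemma det_adj_mx g : \det (adj_mx g) = (\det g)^*.
Proof. by rewrite det_tr det_map_mx. Qed.

Lemma adj_mx_trig g : is_trig_mx g -> is_trig_mx (adj_mx g)^T.
Proof.
move=> /is_trig_mxP h; apply/is_trig_mxP => i j ij.
by rewrite !mxE h // rmorph0.
Qed.

(** Coefficients are dual coordinates to the monomials, so their squared norms are the inverses. *)
Definition bombieri_weight (i : 'I_n) : K := (fischer_weight (fun=> 1) (mon i))^-1.

Let one_gt0 (i : 'I_N) : 0 < (fun=> 1 : K) i. Proof. exact: ltr01. Qed.

Lemma bombieri_weight_gt0 i : 0 < bombieri_weight i.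
Proof. by rewrite invr_gt0; exact: fischer_weight_gt0. Qed.

Local Notation B := (fischer bombieri_weight).

(** Adjointness on forms in N variables, tested on two monomials, becomes the entrywise condition
    that lifts it to polynomials in the coefficients. *)
Lemma coord_mx_adjoint g i j : coord_mx g i j * bombieri_weight j =
  bombieri_weight i * (coord_mx (adj_mx g) j i)^*.
Proof.
have w0 (l : 'I_n) : fischer_weight (fun=> 1 : K) (mon l) != 0.
  by rewrite gt_eqF // fischer_weight_gt0.
have := fischer_adjoint (w := fun=> 1 : K) (A := g) (A' := adj_mx g) one_gt0 _
  'X_[mon j] 'X_[mon i].
rewrite fischer_X (fischerC one_gt0) fischer_X rmorphM /= conjCK.
rewrite [(fischer_weight _ _)^*]conj_Creal; last first.
  by rewrite realE ltW // fischer_weight_gt0.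
rewrite /bombieri_weight !mxE => /(_ _)/wrap[] => [a b|].
  by rewrite !mxE conjCK mulr1 mul1r.
move: (w0 i) (w0 j); move: (_@_(mon i)) (_^*) => x y.
move: (fischer_weight _ (mon i)) (fischer_weight _ (mon j)) => a b a0 b0 e.
by apply: (mulIf a0); rewrite mulrAC e mulfK // mulrAC mulVf // mul1r.
Qed.

Lemma pact_adjoint g p q : B (pact g p) q = B p (pact (adj_mx g) q).
Proof.
apply: fischer_adjoint; [exact: bombieri_weight_gt0 | exact: coord_mx_adjoint].
Qed.

Lemma pactD g p q : pact g (p + q) = pact g p + pact g q.
Proof. exact: comp_mpolyD. Qed.

Lemma pactZ g c p : pact g (c *: p) = c *: pact g p.
Proof. exact: comp_mpolyZ. Qed.

(* [B (pact (g + s) p) q] is polynomial in s and vanishes for all but finitely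
   many s. *)
Lemma pact_big_cell p q :
  (forall l u, is_trig_mx l -> \det l = 1 -> is_trig_mx u^T -> u \in unitmx ->
    B (pact (l *m u) p) q = 0) ->
  forall g, B (pact g p) q = 0.
Proof.
move=> h g; have [delta d0 hd] := scalar_shift_LU g.
have pf : poly_fun (fun s => B (pact (g + s%:M) p) q).
  have hc m : poly_fun (fun s => (pact (g + s%:M) p)@_m).
    apply: poly_fun_lin_subst => i j; under eq_fun do rewrite mxE.
    apply: poly_fun_lin_subst => a b; under eq_fun do rewrite !mxE.
    apply: poly_funD; first exact: poly_fun_const.
    case: (a == b); last by under eq_fun do rewrite mulr0n; exact: poly_fun_const.
    by under eq_fun do rewrite mulr1n; exact: poly_fun_id.
  (* Conjugate symmetry turns the pairing into a sum over the support of q, which does not move with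
     s. *)
  under eq_fun do rewrite (fischerC bombieri_weight_gt0) /fischer rmorph_sum.
  apply: poly_fun_sum => m.
  under eq_fun do rewrite /= !rmorphM /= conjCK.
  apply: poly_funM; first exact: poly_fun_const.
  by apply: poly_funM; [exact: hc | exact: poly_fun_const].
have := poly_fun_eq0 pf d0 _ 0; rewrite raddf0 addr0; apply => s /hd.
by case=> [l [u [tl dl tu uu ->]]]; exact: h.
Qed.

End CoordinateAction.

(** * Irreducibility *)

Section Irreducibility.
Variables (K : numClosedFieldType) (N k d : nat).
Hypotheses (hd : (3 <= d)%N) (hN : (k + 3 <= N)%N).
Local Notation V := (dhomog N K d).
Local Notation n := (size (monomials N d)).
Local Notation E0 := (@Estd K N k d hN).
Local Notation M := (span_fun (Eset K N k d)).
Local Notation D := ((k + 2) * (d - 1))%N.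
Local Notation B := (fischer (@bombieri_weight K N d)).
Implicit Types (phi psi : V -> K) (p q : {mpoly K[n]}) (P : V).

Lemma Eset_polyfun phi : Eset K N k d phi -> homog_polyfun D phi.
Proof. by move=> [f [u [v [_ _ _ _ ->]]]]; exact: Efun_polyfun. Qed.

Lemma Eset_dual_vanish phi : Eset K N k d phi ->
  forall P, Dual K N k d P -> phi P = 0.
Proof.
move=> hphi P [P0 hP]; apply: (hP D); first exact: Eset_polyfun.
by move: hphi => [f [u [v [_ _ _ _ ->]]]] Q [iQ hQ]; exact: Efun_dual_vanish.
Qed.

Lemma Eset_span phi : Eset K N k d phi -> M phi.
Proof.
move=> hphi; exists 1%N, (fun=> 1), (fun=> phi); split=> //.
by apply/funext => P; rewrite big_ord1 mul1r.
Qed.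

Lemma span_submodule : SL_submodule M.
Proof.
split.
- exists 0%N, (fun=> 0), (fun _ _ => 0); split; first by case.
  by apply/funext => P; rewrite big_ord0.
- move=> a b phi psi [n1 [c1 [s1 [h1 ->]]]] [n2 [c2 [s2 [h2 ->]]]].
  exists (n1 + n2)%N,
    (fun i => match split i with inl j => a * c1 j | inr j => b * c2 j end),
    (fun i => match split i with inl j => s1 j | inr j => s2 j end).
  split; first by move=> i; case: split.
  apply/funext => P; rewrite big_split_ord /= !mulr_sumr; congr (_ + _).
    by apply: eq_bigr => i _; rewrite (unsplitK (inl i)) mulrA.
  by apply: eq_bigr => i _; rewrite (unsplitK (inr i)) mulrA.
- move=> g phi dg [m [c [s [hs ->]]]]; exists m, c, (fun i => act g (s i)).
  split=> // i; apply: Eset_act => //.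
  by rewrite unitmxE dg unitr1.
Qed.

Section HighestWeightPolynomial.
Variable p0 : {mpoly K[n]}.
Hypotheses (p0_homog : p0 \is D.-homog) (p0E : forall P, E0 P = p0.@[coords P]).

Lemma act_Estd_pact g P : act g E0 P = (pact g p0).@[coords P].
Proof. by rewrite meval_pact -p0E. Qed.

Lemma Estd_poly_neq0 : p0 != 0.
Proof.
have [P] := Estd_neq0 K hd hN.
by apply: contraNneq => p00; rewrite p0E p00 meval0.
Qed.

Lemma pact_upper b : is_trig_mx b^T -> b \in unitmx ->
  pact b p0 = Omega K N k d b *: p0.
Proof.
move=> tb ub; apply: meval_coords_inj => P.
by rewrite -act_Estd_pact (act_upper_Estd hd) // mevalZ p0E.
Qed.

Lemma span_pact phi : M phi -> exists m (c : 'I_m -> K) (g : 'I_m -> 'M[K]_N),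
  (forall i, \det (g i) = 1) /\
  phi = fun P => (\sum_i c i *: pact (g i) p0).@[coords P].
Proof.
move=> [m [c [s [hs ->]]]].
have h i : exists cg : K * 'M[K]_N, \det cg.2 = 1 /\
    s i = fun P => cg.1 * act cg.2 E0 P.
  have [f [u [v [ff fu fv fuv ->]]]] := hs i.
  have [a [g [dg ->]]] := Efun_orbit hd hN ff fu fv fuv.
  by exists (a, g).
have [cg hcg] := choice h.
exists m, (fun i => c i * (cg i).1), (fun i => (cg i).2); split.
  by move=> i; case: (hcg i).
apply/funext => P; rewrite raddf_sum; apply: eq_bigr => i _ /=.
by rewrite mevalZ -act_Estd_pact; have [_ ->] := hcg i; rewrite mulrA.
Qed.

Lemma highest_weight_unique a :
  (exists2 phi, M phi & phi = fun P => a.@[coords P]) ->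
  (forall b, is_trig_mx b^T -> \det b = 1 -> pact b a = Omega K N k d b *: a) ->
  exists c, a = c *: p0.
Proof.
have w0 := @bombieri_weight_gt0 K N d.
move=> [phi Mphi ephi] ha; set c := B a p0 / B p0 p0.
have Bp0 : B p0 p0 != 0 by apply: contra_neq Estd_poly_neq0; exact: fischer_eq0.
pose y := a - c *: p0.
have By : B p0 y = 0.
  rewrite (fischerC w0) /y -scaleNr fischerDl fischerZl mulNr divfK //.
  by rewrite subrr rmorph0.
have hy b : is_trig_mx b^T -> \det b = 1 -> pact b y = Omega K N k d b *: y.
  move=> tb db; rewrite /y -scaleNr pactD pactZ ha // pact_upper //.
    by rewrite scalerDr !scalerA mulrC.
  by rewrite unitmxE db unitr1.
(* On the big cell g = l u: the factor u scales p0, and l crosses the form as an upper triangular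
   matrix of determinant 1, which scales y. What remains is the pairing of p0 with y, zero by the
   choice of c. *)
have orth g : B (pact g p0) y = 0.
  apply: pact_big_cell => l u tl dl tu uu.
  rewrite pact_mul pact_upper // pactZ fischerZl pact_adjoint hy.
  - by rewrite (fischerZr w0) By !mulr0.
  - exact: adj_mx_trig.
  - by rewrite det_adj_mx dl rmorph1.
have [m [c1 [g1 [_ e1]]]] := span_pact Mphi.
have ea : a = \sum_i c1 i *: pact (g1 i) p0.
  apply: meval_coords_inj => P.
  by have := congr1 (fun f => f P) (etrans (esym ephi) e1).
have p01 : pact 1%:M p0 = p0.
  rewrite pact_upper ?unitmx1 ?trmx1 ?scalar_mx_is_trig // /Omega.
  have h i : fund_weight i (1%:M : 'M[K]_N) = 1.
    by apply: big1 => j _; rewrite mxE eqxx.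
  by rewrite !h !expr1n !mulr1 scale1r.
(* Both a and p0 are combinations of translates of p0, so y is orthogonal to itself. *)
exists c; apply/eqP; rewrite -subr_eq0 -/y; apply/eqP/(fischer_eq0 w0).
rewrite {1}/y -scaleNr fischerDl fischerZl -{1}p01 orth mulr0 addr0.
rewrite ea fischer_suml big1 // => i _.
by rewrite fischerZl orth mulr0.
Qed.

Lemma submodule_extreme (L : set (V -> K)) : SL_submodule L -> L `<=` M ->
  L = [set (fun=> 0)] \/ L = M.
Proof.
have w0 := @bombieri_weight_gt0 K N d.
move=> [L0 Llin Lact] LM.
pose f p : V -> K := fun P => p.@[coords P].
(* Fixing the degree makes this space finite-dimensional, as the projection requires. *)
pose Lp : set {mpoly K[n]} := [set p | p \is D.-homog /\ L (f p)].
have Lp_pact g p : \det g = 1 -> Lp p -> Lp (pact g p).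
  move=> dg [hp Lfp]; split; first exact: pact_homog.
  have -> : f (pact g p) = act g (f p) by apply/funext => P; rewrite /f meval_pact.
  exact: Lact.
have Lp0 : Lp 0.
  split; first exact: dhomog0.
  by rewrite (_ : f 0 = fun=> 0) //; apply/funext => P; rewrite /f meval0.
have Lp_lin (a b : K) p q : Lp p -> Lp q -> Lp (a *: p + b *: q).
  move=> [hp Lfp] [hq Lfq]; split; first by apply: rpredD; apply: rpredZ.
  rewrite (_ : f _ = fun P => a * f p P + b * f q P); first exact: Llin.
  by apply/funext => P; rewrite /f mevalD !mevalZ.
have Lp_homog p : Lp p -> p \is D.-homog by case.
have [a La ha] := fischer_projection w0 Lp_homog Lp0 Lp_lin p0.
have [c ac] : exists c, a = c *: p0.
  apply: highest_weight_unique; first by exists (f a) => //; apply: LM; case: La.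
  move=> b tb db; have ub : b \in unitmx by rewrite unitmxE db unitr1.
  set chi := Omega K N k d b.
  pose x := pact b a - chi *: a.
  have Lx : Lp x.
    have := Lp_lin 1 (- chi) _ _ (Lp_pact b a db La) La.
    by rewrite scale1r scaleNr.
  (* This form of x shows it orthogonal to L, which is stable under the adjoint of b; as x also lies
     in L, it vanishes. *)
  have ex : x = chi *: (p0 - a) - pact b (p0 - a).
    rewrite -scaleN1r pactD pactZ pact_upper // -/chi /x scaleN1r scalerDr.
    by rewrite scalerN scaleN1r; apply/eqP; rewrite -subr_eq0; apply/eqP; ring.
  apply/eqP; rewrite -subr_eq0 -/x; apply/eqP/(fischer_eq0 w0).
  rewrite {1}ex -[- pact b _]scaleN1r fischerDl !fischerZl ha //.
  rewrite pact_adjoint ha ?mulr0 ?addr0 //.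
  by apply: Lp_pact => //; rewrite det_adj_mx db rmorph1.
(* If c = 0, then p0 is orthogonal to L; by stability under adjoints so are all its translates,
   which span a space containing L. Otherwise L contains p0 and all its translates. *)
have [c0|c0] := eqVneq c 0.
  left; apply/seteqP; split=> [phi Lphi|_ ->//].
  have [m [c1 [g1 [dg1 e1]]]] := span_pact (LM _ Lphi).
  set p := \sum_i c1 i *: pact (g1 i) p0 in e1.
  have Lpp : Lp p.
    split; last by rewrite -[f p]/(fun P => p.@[coords P]) -e1.
    by apply: rpred_sum => i _; apply: rpredZ; exact: pact_homog.
  have /(fischer_eq0 w0) p00 : B p p = 0.
    rewrite {1}/p fischer_suml big1 // => i _; rewrite fischerZl pact_adjoint.
    have := ha (pact (adj_mx (g1 i)) p); rewrite ac c0 scale0r subr0 => ->.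
      by rewrite mulr0.
    by apply: Lp_pact => //; rewrite det_adj_mx dg1 rmorph1.
  by rewrite e1 p00; apply/funext => P; rewrite meval0.
right; apply/seteqP; split=> // phi /span_pact [m [c1 [g1 [dg1 ->]]]].
have Lpp0 : Lp p0.
  have := Lp_lin c^-1 0 _ _ La Lp0.
  by rewrite scaler0 addr0 ac scalerA mulVf // scale1r.
have : Lp (\sum_i c1 i *: pact (g1 i) p0).
  elim/big_ind: _ => [//|p q hp hq|i _].
    by have := Lp_lin 1 1 _ _ hp hq; rewrite !scale1r.
  have := Lp_lin (c1 i) 0 _ _ (Lp_pact _ _ (dg1 i) Lpp0) Lp0.
  by rewrite scaler0 addr0.
by case.
Qed.

End HighestWeightPolynomial.

Lemma span_irreducible_highest_weight :
  irreducible_of_highest_weight (Omega K N k d) M.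
Proof.
have [p0 hp0 ep0] : exists2 p0 : {mpoly K[n]}, p0 \is D.-homog &
    forall P, E0 P = p0.@[coords P].
  by apply/homog_polyfunP; apply: Eset_polyfun; exact: Estd_Eset.
have ME0 : M E0 by apply: Eset_span; exact: Estd_Eset.
have E00 : E0 <> fun=> 0.
  have [P /eqP hP] := Estd_neq0 K hd hN.
  by move=> e; apply: hP; rewrite e.
split.
  split; first exact: span_submodule.
    by move=> e; apply: E00; move: ME0; rewrite e.
  by move=> L; exact: (submodule_extreme hp0 ep0).
exists E0 => //; split=> // b tb db.
by apply: act_upper_Estd => //; rewrite unitmxE db unitr1.
Qed.

End Irreducibility.

Theorem theorem2p3p1 (R : realType) (k d N : nat)
    (hd : (3 <= d)%N) (hN : (k + 3 <= N)%N) :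
  [/\ forall phi : dhomog N R[i] d -> R[i], Eset R[i] N k d phi ->
        homog_polyfun ((k + 2) * (d - 1)) phi,
      forall phi : dhomog N R[i] d -> R[i], Eset R[i] N k d phi ->
        forall P : dhomog N R[i] d, Dual R[i] N k d P -> phi P = 0 &
      irreducible_of_highest_weight (Omega R[i] N k d)
        (span_fun (Eset R[i] N k d))].
Proof.
split.
- by move=> phi; exact: Eset_polyfun.
- by move=> phi; exact: Eset_dual_vanish.
- exact: span_irreducible_highest_weight.
Qed.
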